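(* Let $d\ge2$, let $P$ be the uniform distribution on $[0,1]^d$, and let $\mathcal M_d=\{f:[0,1]^d\to\mathbb R:\ f(x)\le f(y)\text{ for any }x\le y\}$. For $f_0\in\mathcal M_d$ let $Y_i=f_0(X_i)+\xi_i$, $i=1,\dots,n$, where $X_1,\dots,X_n$ are i.i.d. with law $P$ and $\xi_1,\dots,\xi_n$ are i.i.d. $\mathcal N(0,1)$ errors independent of the $X_i$'s. Let $\widehat f_n=\arg\min_{f\in\mathcal M_d}\sum_{i=1}^n(Y_i-f(X_i))^2$ be the isotonic least squares estimator. Then, with $\gamma_{d,\mathrm{iso}}=2$ if $d=2$ and $\gamma_{d,\mathrm{iso}}=1$ if $d\ge3$, $$\sup_{f_0\in\mathcal M_d\cap L_\infty(1)}\mathbb E_{f_0}\|\widehat f_n-f_0\|_{L_2(P)}^2\lesssim_d n^{-1/d}\log^{\gamma_{d,\mathrm{iso}}}n.$$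
   Context: $x\le y$ in $[0,1]^d$ means coordinatewise inequality. $L_\infty(1)=\{f:\|f\|_\infty\le1\}$ with $\|f\|_\infty=\sup_x|f(x)|$. $\|f\|_{L_2(P)}^2=\int f^2\,dP$. $\mathbb E_{f_0}$ is expectation under the model with true regression function $f_0$. $a\lesssim_d b$ means $a\le C_d b$ with $C_d$ depending only on $d$. Notational convention: $\log n$ stands for $\log(e\vee n)$.
   Formalization: The argmin is determined only at the design points, and an arbitrary minimizer can have unbounded loss; the result is proved for every least squares estimator over M_d whose values on the cube lie between the smallest and largest response Y_i. *)

(* Defs.v *)
From HB Require Import structures.
From mathcomp Require Import all_boot all_order all_algebra.
From mathcomp Require Import all_classical all_reals all_analysis.
From mathcomp Require Import measurable_realfun.

Set Implicit Arguments.
Unset Strict Implicit.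
Unset Printing Implicit Defensive.

Import Order.TTheory GRing.Theory Num.Theory.
Import numFieldNormedType.Exports.

Local Open Scope classical_set_scope.
Local Open Scope ring_scope.

(* A point of R^d is a d-tuple, with the product sigma-algebra of the library.
   A function [0,1]^d -> R is represented by a function on d-tuples; its values
   outside [unit_cube] are never constrained nor integrated. *)

Definition unit_cube {R : realType} {d : nat} : set (d.-tuple R) :=
  [set x | forall k : 'I_d, 0 <= tnth x k <= 1].

(* The order that the library puts on tuples is not the coordinatewise one. *)
Definition le_coord {R : realType} {d : nat} (x y : d.-tuple R) : Prop :=
  forall k : 'I_d, tnth x k <= tnth y k.

Definition monotone_class (R : realType) (d : nat) : set (d.-tuple R -> R) :=
  [set f | forall x y, unit_cube x -> unit_cube y -> le_coord x y ->
    f x <= f y].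

Definition sup_norm {R : realType} {d : nat} (f : d.-tuple R -> R) : \bar R :=
  ereal_sup [set `|f x|%:E | x in unit_cube].

Definition Linfty_ball (R : realType) (d : nat) (r : R)
    : set (d.-tuple R -> R) :=
  [set f | (sup_norm f <= r%:E)%E].

Section uniform_on_the_cube.
Context {R : realType}.

Definition cube_cons (d : nat) (z : measurableTypeR R * d.-tuple R) :
  d.+1.-tuple R := [the d.+1.-tuple R of z.1 :: z.2].

Lemma measurable_cube_cons (d : nat) : measurable_fun [set: _] (@cube_cons d).
Proof. exact: measurable_cons. Qed.

HB.instance Definition _ (d : nat) := @isMeasurableFun.Build _ _ _ _
  (@cube_cons d) (@measurable_cube_cons d).

(* The uniform distribution on [0,1]^d, as the d-fold product of the uniform
   distribution on [0,1]. *)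
Fixpoint uniform_cube (d : nat) : probability (d.-tuple R) R :=
  match d with
  | 0 => \d_([tuple])
  | d'.+1 => distribution
      (uniform_prob (@ltr01 R) \x uniform_cube d')%E (@cube_cons d')
  end.

End uniform_on_the_cube.

(* A monotone function on [0,1]^d need not be Borel, but it agrees with a Borel
   function outside a Borel null set. The library's integral of a nonnegative
   function f is the supremum of the integrals of the simple functions below f,
   hence for such functions it is the integral for the completed measure. *)
Definition sq_L2_norm {R : realType} {d : nat} (f : d.-tuple R -> R) : \bar R :=
  (\int[@uniform_cube R d]_(x in unit_cube) (f x ^+ 2)%:E)%E.

Section probability_notions.
Context {disp : measure_display} {T : measurableType disp} {R : realType}.
Variable Pr : probability T R.

(* [distribution] gives a value to every set; only the measurable ones matter. *)
Definition has_law (disp' : measure_display) (U : measurableType disp')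
    (X : {RV Pr >-> U}) (mu : set U -> \bar R) : Prop :=
  forall A : set U, measurable A -> distribution Pr X A = mu A.

Definition mutually_independent (disp' : measure_display)
    (U : measurableType disp') (I : finType) (X : I -> {RV Pr >-> U}) : Prop :=
  forall (J : {set I}) (A : I -> set U), (forall i, measurable (A i)) ->
    Pr (\bigcap_(i in [set` J]) (X i @^-1` A i)) =
    (\prod_(i in J) Pr (X i @^-1` A i))%E.

Definition independent_pair (disp1 disp2 : measure_display)
    (U1 : measurableType disp1) (U2 : measurableType disp2)
    (X : T -> U1) (Y : T -> U2) : Prop :=
  forall (A : set U1) (B : set U2), measurable A -> measurable B ->
    Pr (X @^-1` A `&` Y @^-1` B) = (Pr (X @^-1` A) * Pr (Y @^-1` B))%E.

(* Outer expectation, so that no measurability has to be assumed of a map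
   selecting a minimizer; see [outer_expectationE]. *)
Definition outer_expectation (Z : T -> \bar R) : \bar R :=
  ereal_inf [set (\int[Pr]_w g w)%E |
    g in [set g : T -> \bar R |
      measurable_fun setT g /\ forall w, (Z w <= g w)%E]].

Lemma outer_expectationE (Z : T -> \bar R) :
  measurable_fun setT Z -> (forall w, (0 <= Z w)%E) ->
  outer_expectation Z = (\int[Pr]_w Z w)%E.
Proof.
move=> mZ Z0; apply/eqP; rewrite eq_le; apply/andP; split.
  by apply: ereal_inf_lbound; exists Z.
apply: le_ereal_inf_tmp => _ [g [mg Zg] <-].
by apply: ge0_le_integral => // w _; exact: le_trans (Zg w).
Qed.

End probability_notions.

Section isotonic_regression.
Context {R : realType} {d n : nat}.

Definition residual_sum (x : n.-tuple (d.-tuple R)) (y : n.-tuple R)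
    (f : d.-tuple R -> R) : R :=
  \sum_(i < n) (tnth y i - f (tnth x i)) ^+ 2.

Definition is_isotonic_lse (x : n.-tuple (d.-tuple R)) (y : n.-tuple R)
    (f : d.-tuple R -> R) : Prop :=
  monotone_class f /\
  forall g, monotone_class g -> residual_sum x y f <= residual_sum x y g.

(* The least squares criterion determines its minimizer only at the design
   points. Almost surely, the points of the cube that lie above no design point
   form a set of positive volume, on which a minimizer can be made arbitrarily
   negative, and its loss arbitrarily large. Hence the requirement that the
   extension to the cube stays within the range of the responses. *)
Definition within_response_range (y : n.-tuple R) (f : d.-tuple R -> R)
    : Prop :=
  forall z, unit_cube z -> exists i j : 'I_n, tnth y i <= f z <= tnth y j.

(* Any minimizer can be truncated so as to meet this requirement. *)
Lemma truncated_isotonic_lse (x : n.-tuple (d.-tuple R)) (y : n.-tuple R)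
    (f : d.-tuple R -> R) (a b : 'I_n) :
  (forall i, tnth y a <= tnth y i <= tnth y b) ->
  is_isotonic_lse x y f ->
  let f' := fun z => Num.max (tnth y a) (Num.min (tnth y b) (f z)) in
  is_isotonic_lse x y f' /\ within_response_range y f'.
Proof.
move=> yab [fm fmin] f'; have /andP[_ ab] := yab a.
split; last first.
  move=> z _; exists a, b; rewrite /f' le_max lexx/= ge_max ab/=.
  by rewrite ge_min lexx.
split=> [u v uc vc uv|g gm].
  have fuv := fm _ _ uc vc uv.
  rewrite /f' ge_max !le_max lexx/=; apply/orP; right.
  by rewrite le_min !ge_min lexx/= fuv orbT.
apply: le_trans (fmin _ gm); apply: ler_sum => i _.
have /andP[ai ib] := yab i.
rewrite -ler_sqrt ?sqr_ge0// !sqrtr_sqr /f'.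
set t := f _; set yi := tnth y i in ai ib *.
case: (leP (tnth y b) t) => [bt|tb].
  rewrite max_r// distrC (distrC yi) !ger0_norm ?subr_ge0//.
    by rewrite lerD2r.
  exact: le_trans bt.
case: (leP (tnth y a) t) => [//|ta].
rewrite !ger0_norm ?subr_ge0//; first by rewrite lerD2l lerN2 ltW.
exact: le_trans (ltW ta) ai.
Qed.

Section model.
Context {disp : measure_display} {T : measurableType disp}.
Variable Pr : probability T R.
Variables (X : 'I_n -> {RV Pr >-> d.-tuple R}) (xi : 'I_n -> {RV Pr >-> R}).

Definition covariates (w : T) : n.-tuple (d.-tuple R) := [tuple X i w | i < n].

Definition errors (w : T) : n.-tuple R := [tuple xi i w | i < n].

Definition responses (f0 : d.-tuple R -> R) (w : T) : n.-tuple R :=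
  [tuple f0 (X i w) + xi i w | i < n].

Record gaussian_random_design : Prop := GaussianRandomDesign {
  covariate_law : forall i, has_law (X i) (@uniform_cube R d) ;
  covariate_indep : mutually_independent X ;
  error_law : forall i, has_law (xi i) (normal_prob 0 1) ;
  error_indep : mutually_independent xi ;
  covariate_error_indep : independent_pair Pr covariates errors }.

End model.

End isotonic_regression.

Definition gamma_iso (d : nat) : nat := if d == 2 then 2 else 1.

(* Main.v *)
(* The slow-rate argument. Comparing the least squares estimator [f] with the
   truth [f0] gives
     sum_i (f - f0)^2 (X_i) <= 2 sum_i xi_i (f - f0) (X_i),
   and [|f| <= M] with M of order sqrt (log n), up to an event on which the loss
   is controlled by the exponential moments of xi_i^2. By the layer-cake formula,
   the right-hand side and the difference between the empirical and the
   population L2 norms (where (f - f0)^2 = f^2 - 2 f f0 + f0^2 is, after adding M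
   to f and f0, a combination of monotone functions) are bounded, up to factors M
   and M^2, by the suprema over the upper sets U of
     |sum_i 1_U (X_i) xi_i|   and   |sum_i (1_U (X_i) - P (U))|.
   These are bounded by chaining along dyadic grids, from mesh 1 to a mesh
   2^-J of order n^(-1/d). At mesh 1/m the inner approximation of U is one of at
   most 4^(m^(d-1)) unions of cells, and it differs from the previous one by at
   most 2d m^(d-1) cells, hence by a set of probability at most 2d/m. The j-th
   link therefore costs sqrt (n 2^(j(d-2))). The sum of these costs is geometric
   if d >= 3 and has J + 1 equal terms if d = 2, which is the additional
   logarithm; the cells that meet the boundary of U at mesh 2^-J cost
   n^(1-1/d). *)

Require Import Defs.
From HB Require Import structures.
From mathcomp Require Import all_boot all_order all_algebra.
From mathcomp Require Import zify.

Set Implicit Arguments.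
Unset Strict Implicit.
Unset Printing Implicit Defensive.

(** * Upper sets of a finite grid *)

(** The obstacle that shapes the proof is measurability: upper sets, monotone functions and the
    estimator need not be Borel. The probabilistic part therefore handles only finite families of
    unions of dyadic cells, and delivers for each process one measurable majorant [G] of controlled
    mean, fixed before the upper set and the sample point. The estimator enters through a
    deterministic inequality, valid at every sample point whose covariates lie in the cube. For the
    same reason sums are centred at the probability of the inner approximation of [U], and integrals
    of monotone functions give way to Darboux sums over cells.

    The one probabilistic estimate is an exponential moment of a sum restricted to a union of cells.
    On the links at mesh 1/m it is used with parameter l^2 = m^d / n, which makes n l^2 / m, the
    cost of the variance, of the same order as the entropy m^(d-1). The quadratic bound on the
    exponential needs l <= 1, that is m^d <= n, and there the chain stops.

    The factor M^2, of order log n, is the logarithm that remains in every dimension. *)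

Definition cell (d m : nat) := {ffun 'I_d -> 'I_m}.

Definition cell_le {d m : nat} (c c' : cell d m) : bool :=
  [forall k, (c k <= c' k)%N].

Definition is_upset {d m : nat} (g : {set cell d m}) : bool :=
  [forall c, forall c', (c \in g) && cell_le c c' ==> (c' \in g)].

Definition upsets (d m : nat) : {set {set cell d m}} := [set g | is_upset g].

(** The upper corner of [c] is then the lower corner of [c']; this is how one sees on the grid that
    an upper set crosses a cell. *)
Definition diag_succ {d m : nat} (c c' : cell d m) : bool :=
  [forall k, (c' k == (c k).+1 :> nat)].

Lemma upsetP d m (g : {set cell d m}) :
  reflect (forall c c', c \in g -> cell_le c c' -> c' \in g) (g \in upsets d m).
Proof.
rewrite inE; apply: (iffP forallP) => [H c c' cg cc'|H c].
  by have /forallP/(_ c') := H c; rewrite cg cc'.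
by apply/forallP => c'; apply/implyP => /andP[]; exact: H.
Qed.

Lemma card_cell d m : #|{: cell d m}| = (m ^ d)%N.
Proof. by rewrite card_ffun !card_ord. Qed.

Lemma card_face d m (v : nat) (k : 'I_d) :
  (#|[set c : cell d m | c k == v :> nat]| <= m ^ d.-1)%N.
Proof.
have -> : [set c : cell d m | c k == v :> nat] =
    [set c in family (fun i => [pred a : 'I_m | (i == k) ==> (a == v :> nat)])].
  apply/setP => c; rewrite !inE; apply/idP/forallP => [ck i|/(_ k)] /=.
    by rewrite inE; apply/implyP => /eqP ->.
  by rewrite inE eqxx.
rewrite cardsE card_family.
rewrite -[foldr _ _ _]/(foldr muln 1%N (map _ _)) foldrE big_map big_enum /=.
rewrite (bigD1 k) //=.
have le1 : (#|[pred a : 'I_m | (k == k) ==> (a == v :> nat)]| <= 1)%N.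
  apply/card_le1_eqP => a b; rewrite !inE eqxx /= => /eqP av /eqP bv.
  by apply: val_inj; rewrite /= av bv.
apply: (@leq_trans (1 * \prod_(i < d | i != k) m)%N).
  apply: leq_mul => //; apply: leq_prod => i ik.
  by rewrite -[X in (_ <= X)%N]card_ord; apply: max_card.
by rewrite mul1n prod_nat_const cardC1 card_ord.
Qed.

Lemma card_faces d m (v : nat) :
  (#|[set c : cell d m | [exists k, c k == v :> nat]]| <= d * m ^ d.-1)%N.
Proof.
have -> : [set c : cell d m | [exists k, c k == v :> nat]] =
    \bigcup_(k < d) [set c : cell d m | c k == v :> nat].
  apply/setP => c; rewrite inE; apply/existsP/bigcupP => [[k ck]|[k _]].
    by exists k; rewrite ?inE.
  by rewrite inE => ck; exists k.
apply: (@leq_trans (\sum_(k < d) m ^ d.-1)%N); last first.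
  by rewrite sum_nat_const card_ord.
elim/big_ind2: _ => [|A a B b Aa Bb|k _]; first by rewrite cards0.
  by apply: leq_trans (leq_card_setU _ _) _; exact: leq_add.
exact: card_face.
Qed.

Section fringe.
Variables (d m : nat) (g : {set cell d m}).

Definition outer_fringe : {set cell d m} :=
  [set c in ~: g | [exists c' in g, diag_succ c c']].

(** Cells of the top faces have no diagonal successor, so the grid cannot tell whether the upper set
    enters them; they are always counted. *)
Definition upper_boundary : {set cell d m} :=
  outer_fringe :|: [set c : cell d m | [exists k, c k == m.-1 :> nat]].

Definition inner_fringe : {set cell d m} :=
  [set c in g | [exists c' in ~: g, diag_succ c' c]].

Definition lower_boundary : {set cell d m} :=
  inner_fringe :|: [set c : cell d m | [exists k, c k == 0%N :> nat]].

Lemma diag_succ_inj (c c' e : cell d m) :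
  diag_succ c e -> diag_succ c' e -> c = c'.
Proof.
move=> /forallP H /forallP H'; apply/ffunP => k; apply: val_inj => /=.
by have /eqP := H k; have /eqP -> := H' k => -[].
Qed.

Lemma diag_succ_fun (c e e' : cell d m) :
  diag_succ c e -> diag_succ c e' -> e = e'.
Proof.
move=> /forallP H /forallP H'; apply/ffunP => k; apply: val_inj => /=.
by have /eqP -> := H k; have /eqP -> := H' k.
Qed.

Lemma diag_succ_le (c e : cell d m) : diag_succ c e -> cell_le c e.
Proof. by move=> /forallP H; apply/forallP => k; rewrite (eqP (H k)) leqnSn. Qed.

Lemma diag_succ_ex (c : cell d m) :
  ~~ [exists k, c k == m.-1 :> nat] -> exists e, diag_succ c e.
Proof.
rewrite negb_exists => /forallP H.
have lt k : ((c k).+1 < m)%N by have := H k; have := ltn_ord (c k); lia.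
by exists [ffun k => Ordinal (lt k)]; apply/forallP => k; rewrite ffunE.
Qed.

Lemma diag_pred_ex (c : cell d m) :
  ~~ [exists k, c k == 0%N :> nat] -> exists e, diag_succ e c.
Proof.
rewrite negb_exists => /forallP H.
have lt k : ((c k).-1 < m)%N by have := ltn_ord (c k); lia.
exists [ffun k => Ordinal (lt k)]; apply/forallP => k; rewrite ffunE /=.
by have := H k; lia.
Qed.

(* The diagonal shift embeds [outer_fringe] and the part of [g] off the top
   faces, which are disjoint, into [g]. *)
Lemma card_outer_fringe :
  g \in upsets d m -> (#|outer_fringe| <= d * m ^ d.-1)%N.
Proof.
move=> /upsetP ug.
set top := [set c : cell d m | [exists k, c k == m.-1 :> nat]].
pose s (c : cell d m) := odflt c [pick e | diag_succ c e].
have sP c e : diag_succ c e -> s c = e.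
  rewrite /s; case: pickP => [e' ce' ce|/(_ e) -> //].
  exact: diag_succ_fun ce' ce.
have dom c : c \in outer_fringe :|: (g :\: top) -> diag_succ c (s c) /\ s c \in g.
  rewrite in_setU => /orP[|].
    by rewrite inE => /andP[_ /existsP[e /andP[eg ce]]]; rewrite (sP _ _ ce).
  rewrite in_setD => /andP[]; rewrite inE => /diag_succ_ex[e ce] cg.
  by rewrite (sP _ _ ce); split => //; apply: ug cg (diag_succ_le ce).
have injs : {in outer_fringe :|: (g :\: top) &, injective s}.
  move=> c c' /dom[cs _] /dom[cs' _] e.
  by apply: (diag_succ_inj cs); rewrite e.
have sub : s @: (outer_fringe :|: (g :\: top)) \subset g.
  by apply/subsetP => _ /imsetP[c /dom[_ ?] ->].
have := subset_leq_card sub; rewrite card_in_imset // cardsU.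
have -> : outer_fringe :&: (g :\: top) = set0.
  by apply/setP => c; rewrite !inE; case: (c \in g); rewrite ?andbF.
rewrite cards0 subn0 cardsD.
rewrite addnBA ?subset_leq_card ?subsetIl // leq_subLR leq_add2r.
move=> /leq_trans; apply; apply: leq_trans (card_faces d m m.-1).
exact/subset_leq_card/subsetIr.
Qed.

Lemma card_upper_boundary :
  g \in upsets d m -> (#|upper_boundary| <= 2 * d * m ^ d.-1)%N.
Proof.
move=> ug; rewrite -mulnA mul2n -addnn.
apply: leq_trans (leq_card_setU _ _) _.
by apply: leq_add; [exact: card_outer_fringe|exact: card_faces].
Qed.

(** The diagonal predecessor injects [inner_fringe] into [outer_fringe], so the bound on the latter
    serves for both. *)
Lemma card_lower_boundary :
  g \in upsets d m -> (#|lower_boundary| <= 2 * d * m ^ d.-1)%N.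
Proof.
move=> ug; rewrite -mulnA mul2n -addnn.
apply: leq_trans (leq_card_setU _ _) _.
apply: leq_add; last exact: card_faces.
apply: leq_trans (card_outer_fringe ug).
pose p (c : cell d m) := odflt c [pick e | diag_succ e c].
have pP c e : diag_succ e c -> p c = e.
  rewrite /p; case: pickP => [e' ce' ce|/(_ e) -> //].
  exact: diag_succ_inj ce' ce.
rewrite -(@card_in_imset _ _ p).
  apply/subset_leq_card/subsetP => _ /imsetP[c + ->].
  rewrite inE => /andP[cg /existsP[e /andP[eg ec]]]; rewrite (pP _ _ ec).
  by rewrite inE eg /=; apply/existsP; exists c; rewrite cg.
move=> c c'; rewrite inE => /andP[_ /existsP[e /andP[_ ec]]].
rewrite inE => /andP[_ /existsP[e' /andP[_ ec']]].
rewrite (pP _ _ ec) (pP _ _ ec') => ee; rewrite -{}ee in ec'.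
exact: diag_succ_fun ec ec'.
Qed.

End fringe.

Section counting.
Variables (d m : nat).

Let cell3 (a b : 'I_m) (r : cell d m) : cell d.+2 m :=
  [ffun i : 'I_d.+2 =>
    if unlift ord0 i is Some j then (if unlift ord0 j is Some k then r k else b)
    else a].

Let cell3_ex (c : cell d.+2 m) : exists a b r, c = cell3 a b r.
Proof.
exists (c ord0), (c (lift ord0 ord0)), [ffun k => c (lift ord0 (lift ord0 k))].
apply/ffunP => i; rewrite ffunE; case: unliftP => [j ->|-> //].
by case: unliftP => [k ->|-> //]; rewrite ffunE.
Qed.

Let cell3_le (a a' b b' : 'I_m) r :
  (a <= a')%N -> (b <= b')%N -> cell_le (cell3 a b r) (cell3 a' b' r).
Proof.
move=> aa bb; apply/forallP => i; rewrite !ffunE.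
by case: unliftP => [j _|//]; case: unliftP.
Qed.

(** An up-closed subset of a chain is a final segment, hence determined by its cardinality. This
    makes the column heights of an upset a faithful code for it. *)
Lemma mem_upclosed (S : {set 'I_m}) (b : 'I_m) :
  (forall b b' : 'I_m, b \in S -> (b <= b')%N -> b' \in S) ->
  (b \in S) = (m - b <= #|S|)%N.
Proof.
move=> up.
have ge_card (i : nat) : (i <= m)%N -> #|[set b' : 'I_m | (i <= b')%N]| = (m - i)%N.
  move=> im; rewrite cardsE -sum1_card big_mkcond /=.
  rewrite -(big_mkord xpredT (fun j => if (i <= j)%N then 1%N else 0%N)).
  rewrite (big_cat_nat (n := i)) //= [X in (X + _)%N]big1_seq ?add0n; last first.
    by move=> j /=; rewrite mem_index_iota => /andP[_ ji]; rewrite leqNgt ji.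
  under eq_big_nat => j /andP[-> _] do [].
  by rewrite sum_nat_const_nat muln1.
apply/idP/idP => [bS|].
  rewrite -(ge_card b (ltnW (ltn_ord b))).
  by apply/subset_leq_card/subsetP => b'; rewrite inE; exact: up bS.
apply: contraTT => bS; rewrite -ltnNge.
apply: (@leq_ltn_trans #|[set b' : 'I_m | (b.+1 <= b')%N]|).
  apply/subset_leq_card/subsetP => b' b'S; rewrite inE ltnNge.
  by apply: contra bS => /(up _ _ b'S).
by rewrite (ge_card b.+1 (ltn_ord b)); have := ltn_ord b; lia.
Qed.

(* Fixing all but two coordinates, an upset is the region above a monotone
   staircase in a square of side [m], and there are ['C(m + m, m)] of these. *)
Lemma card_upsets : (#|upsets d.+2 m| <= 4 ^ (m ^ d.+1))%N.
Proof.
pose h (g : {set cell d.+2 m}) (r : cell d m) (a : 'I_m) :=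
  #|[set b | cell3 a b r \in g]|.
have hlt g r a : (h g r a < m.+1)%N.
  by rewrite ltnS -[X in (_ <= X)%N](card_ord m) max_card.
pose H g : {ffun cell d m -> m.-tuple 'I_m.+1} :=
  [ffun r => [tuple Ordinal (hlt g r a) | a < m]].
pose S := [set t : m.-tuple 'I_m.+1 | sorted leq [seq val i | i <- t]].
have Hinj : {in upsets d.+2 m &, injective H}.
  move=> g g' /upsetP ug /upsetP ug' e.
  apply/setP => c; have [a [b [r ->]]] := cell3_ex c.
  have mem (f : {set cell d.+2 m}) :
      (forall c c', c \in f -> cell_le c c' -> c' \in f) ->
      (cell3 a b r \in f) = (m - b <= h f r a)%N.
    move=> uf; rewrite -(@mem_upclosed [set b | cell3 a b r \in f] b) ?inE //.
    by move=> x y; rewrite !inE => /uf + xy; apply; exact: cell3_le.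
  rewrite (mem g) // (mem g') //; congr (_ <= _)%N.
  have /ffunP/(_ r) := e; rewrite !ffunE => /(congr1 (fun t => val (tnth t a))).
  by rewrite !tnth_mktuple.
rewrite -(card_in_imset Hinj).
apply: (@leq_trans #|[set f : {ffun cell d m -> m.-tuple 'I_m.+1} | f \in ffun_on (mem S)]|).
  apply/subset_leq_card/subsetP => _ /imsetP[g /upsetP ug ->].
  rewrite inE; apply/ffun_onP => r; rewrite ffunE inE.
  rewrite /= -map_comp (eq_map (g := h g r)) //.
  apply: (homo_sorted (e := fun i j : 'I_m => (i <= j)%N)) => [a a' aa'|].
    apply/subset_leq_card/subsetP => b; rewrite !inE => /ug; apply.
    exact: cell3_le.
  by have := iota_sorted 0 m; rewrite -val_enum_ord sorted_map.
rewrite cardsE card_ffun_on card_cell card_sorted_tuples.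
have -> : (4 ^ m ^ d.+1 = (4 ^ m) ^ (m ^ d))%N by rewrite -expnM expnS.
have [->|md0] := posnP (m ^ d)%N; first by rewrite !expn0.
rewrite leq_exp2r //.
(* The central binomial coefficient is a single term of the expansion of (1 + 1)^(2m) = 4^m. *)
have := expnDn 1 1 (m + m); rewrite addn1 addnn -muln2 mulnC expnM => ->.
have lt : (m < (2 * m).+1)%N by lia.
by rewrite (bigD1 (Ordinal lt)) //= !exp1n !muln1 leq_addr.
Qed.

End counting.

From mathcomp Require Import all_classical all_reals all_analysis.
From mathcomp Require Import measurable_realfun.
From mathcomp Require Import ring lra.

Import Order.TTheory GRing.Theory Num.Theory.
Import numFieldNormedType.Exports.

Local Open Scope classical_set_scope.
Local Open Scope ring_scope.

(** * Integration against independent factors *)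

Section weighted_integral.
Context {d1 d2 : measure_display} {T : measurableType d1}
  {U : measurableType d2} {R : realType}.
Variables (la : {measure set T -> \bar R}) (mu : {measure set U -> \bar R}).
Variables (Y : T -> U) (W : T -> R) (w : R).
Hypotheses (mY : measurable_fun setT Y) (mW : measurable_fun setT W).
Hypothesis W0 : forall x, 0 <= W x.
Hypothesis YW : forall A, measurable A ->
  (\int[la]_x (\1_A (Y x) * W x)%:E = mu A * w%:E)%E.

Import HBNNSimple.

Let weighted_nnsfun (h : {nnsfun U >-> R}) :
  (\int[la]_x (h (Y x) * W x)%:E = w%:E * \int[mu]_y (h y)%:E)%E.
Proof.
have mI (r : R) : measurable_fun setT (fun x => \1_(h @^-1` [set r]) (Y x) : R).
  exact: measurableT_comp.
transitivity (\int[la]_x (\sum_(r \in range h)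
    (r%:E * (\1_(h @^-1` [set r]) (Y x) * W x)%:E)))%E.
  apply: eq_integral => x _; rewrite fimfunE mulr_fsuml -fsumEFin//.
  by apply: eq_fsbigr => r _; rewrite -EFinM mulrA.
rewrite ge0_integral_fsum//; last 2 first.
- move=> r; apply/measurable_funeM/measurable_EFinP.
  exact: measurable_funM.
- move=> r x _; rewrite -EFinM lee_fin mulrA mulr_ge0//.
  by have := nnfun_muleindic_ge0 h r (Y x); rewrite -EFinM lee_fin.
have -> : (\int[mu]_y (h y)%:E = \sum_(r \in range h)
    r%:E * mu (h @^-1` [set r]))%E.
  rewrite integralT_nnsfun sintegralE.
  by [].
rewrite ge0_mule_fsumr; last first.
  by move=> r; exact: nnsfun_mulemu_ge0.
apply: eq_fsbigr => r; rewrite inE => -[y _ hy].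
have r0 : 0 <= r by rewrite -hy.
rewrite ge0_integralZl_EFin//; last first.
  by apply/measurable_EFinP; exact: measurable_funM.
  by move=> x _; rewrite lee_fin mulr_ge0.
rewrite [X in (_ * X)%E](_ : _ = (mu (h @^-1` [set r]) * w%:E)%E); last exact: YW.
by rewrite muleA muleC.
Qed.

(** Passage from indicators to nonnegative functions by simple approximation. It serves three
    purposes: integrating against a density ([Y] the identity), changing variables under a law ([W]
    constant), and replacing one factor of a product of independent variables ([W] the remaining
    factors). *)
Lemma ge0_integral_weighted (h : U -> R) :
  measurable_fun setT h -> (forall y, 0 <= h y) ->
  (\int[la]_x (h (Y x) * W x)%:E = w%:E * \int[mu]_y (h y)%:E)%E.
Proof.
move=> mh h0.
have mh' : measurable_fun setT (EFin \o h) by exact/measurable_EFinP.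
pose f_ := nnsfun_approx measurableT mh'.
have cvgf y : (f_ n y)%:E @[n --> \oo] --> (h y)%:E.
  by apply: (@cvg_nnsfun_approx _ _ _ _ measurableT _ mh') => // z _; rewrite lee_fin.
have ndf y m n : (m <= n)%N -> f_ m y <= f_ n y.
  by move=> mn; exact/lefP/nd_nnsfun_approx.
transitivity (limn (fun n => \int[la]_x (f_ n (Y x) * W x)%:E)%E).
  rewrite -monotone_convergence//=.
  - apply: eq_integral => x _; apply/esym/cvg_lim => //.
    under eq_fun do rewrite EFinM.
    by rewrite EFinM; apply: cvgeZr => //; exact: cvgf.
  - move=> n; apply/measurable_EFinP/measurable_funM => //.
    exact: measurableT_comp.
  - by move=> n x _; rewrite lee_fin mulr_ge0.
  - by move=> x _ m n mn; rewrite lee_fin ler_wpM2r// ndf.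
under eq_fun do rewrite weighted_nnsfun.
have := @monotone_convergence _ _ _ mu setT measurableT (fun n y => (f_ n y)%:E).
have -> : (\int[mu]_y (h y)%:E = \int[mu]_y limn (fun n => (f_ n y)%:E))%E.
  by apply: eq_integral => y _; apply/esym/cvg_lim => //; exact: cvgf.
move=> ->.
- rewrite limeMl//.
  apply: ereal_nondecreasing_is_cvgn => m n mn; apply: ge0_le_integral => //.
  + by move=> y _; rewrite lee_fin.
  + by apply/measurable_EFinP.
  + by apply/measurable_EFinP.
  + by move=> y _; rewrite lee_fin ndf.
- by move=> n; apply/measurable_EFinP.
- by move=> n y _; rewrite lee_fin.
- by move=> y _ m n mn; rewrite lee_fin ndf.
Qed.

End weighted_integral.

Lemma measurable_tuple_box {disp : measure_display} {U : measurableType disp}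
    (n : nat) (B : 'I_n -> set U) : (forall i, measurable (B i)) ->
  measurable [set x : n.-tuple U | forall i, B i (tnth x i)].
Proof.
move=> mB.
have -> : [set x : n.-tuple U | forall i, B i (tnth x i)] =
    \bigcap_(i in [set: 'I_n]) ((@tnth n U)^~ i @^-1` B i).
  by apply/seteqP; split=> x /= H i *; exact: H.
apply: fin_bigcap_measurable; first exact: finite_finset.
move=> i _; rewrite -[X in measurable X]setTI.
exact: (measurable_tnth i).
Qed.

Lemma prod_indic {T : Type} {R : realType} (n : nat) (B : 'I_n -> set T)
    (x : 'I_n -> T) :
  \prod_(i < n) \1_(B i) (x i) = (`[< forall i, B i (x i) >])%:R :> R.
Proof.
case: asboolP => [H|/existsNP[i Bi]].
  by rewrite big1// => i _; rewrite indicE mem_set.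
by rewrite (bigD1 i)//= indicE memNset// mul0r.
Qed.

Section independent_products.
Context {R : realType} {d n : nat} {disp : measure_display}
  {T : measurableType disp}.
Variable Pr : probability T R.
Variables (X : 'I_n -> {RV Pr >-> d.-tuple R}) (xi : 'I_n -> {RV Pr >-> R}).
Hypothesis model : gaussian_random_design X xi.

Let boxX (D : 'I_n -> set (d.-tuple R)) : (forall i, measurable (D i)) ->
  Pr (covariates X @^-1` [set x | forall i, D i (tnth x i)]) =
  (\prod_(i < n) uniform_cube d (D i))%E.
Proof.
move=> mD.
have -> : covariates X @^-1` [set x | forall i, D i (tnth x i)] =
    \bigcap_(i in [set` [set: 'I_n]%SET]) (X i @^-1` D i).
  apply/seteqP; split=> w /= H i; last first.
    by have := H i; rewrite tnth_mktuple; apply; rewrite /= inE.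
  by move=> _; have := H i; rewrite tnth_mktuple.
rewrite (covariate_indep model)//; apply: eq_big => [i|i _]; first by rewrite inE.
exact: (covariate_law model i (mD i)).
Qed.

Let boxxi (A : 'I_n -> set R) : (forall i, measurable (A i)) ->
  Pr (errors xi @^-1` [set x | forall i, A i (tnth x i)]) =
  (\prod_(i < n) normal_prob 0 1 (A i))%E.
Proof.
move=> mA.
have -> : errors xi @^-1` [set x | forall i, A i (tnth x i)] =
    \bigcap_(i in [set` [set: 'I_n]%SET]) (xi i @^-1` A i).
  apply/seteqP; split=> w /= H i; last first.
    by have := H i; rewrite tnth_mktuple; apply; rewrite /= inE.
  by move=> _; have := H i; rewrite tnth_mktuple.
rewrite (error_indep model)//; apply: eq_big => [i|i _]; first by rewrite inE.
exact: (error_law model i (mA i)).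
Qed.

Lemma measurable_covariates : measurable_fun setT (covariates X).
Proof.
by apply/measurable_fun_tnthP => i; rewrite (_ : _ \o _ = X i)//; apply/funext => w /=;
  rewrite tnth_mktuple.
Qed.

Lemma measurable_errors : measurable_fun setT (errors xi).
Proof.
by apply/measurable_fun_tnthP => i; rewrite (_ : _ \o _ = xi i)//; apply/funext => w /=;
  rewrite tnth_mktuple.
Qed.

Let prodE (I : Type) (r : seq I) (P : pred I) (f : I -> R) :
  (\prod_(i <- r | P i) (f i)%:E)%E = (\prod_(i <- r | P i) f i)%:E.
Proof. by elim/big_rec2: _ => // i x y _ ->; rewrite EFinM. Qed.

Lemma integral_prod_indep (D : 'I_n -> set (d.-tuple R)) (h : 'I_n -> R -> R)
    (p e : 'I_n -> R) :
  (forall i, measurable (D i)) -> (forall i, uniform_cube d (D i) = (p i)%:E) ->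
  (forall i, measurable_fun setT (h i)) -> (forall i x, 0 <= h i x) ->
  (forall i, (\int[normal_prob 0 1]_x (h i x)%:E = (e i)%:E)%E) ->
  (\int[Pr]_w (\prod_(i < n) (\1_(D i) (X i w) * h i (xi i w)))%:E =
   (\prod_(i < n) (p i * e i))%:E)%E.
Proof.
move=> mD Dp mh h0 he.
have p0 i : 0 <= p i by rewrite -lee_fin -Dp.
have e0 i : 0 <= e i by rewrite -lee_fin -he integral_ge0// => x _; rewrite lee_fin.
pose q (A : set R) : R := fine (normal_prob 0 1 A).
have qE A : measurable A -> normal_prob 0 1 A = (q A)%:E.
  by move=> mA; rewrite fineK// fin_num_measure.
have q0 A : 0 <= q A by rewrite fine_ge0.
pose k t (A : 'I_n -> set R) (i : 'I_n) w : R :=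
  if (i < t)%N then h i (xi i w) else \1_(A i) (xi i w).
pose c t (A : 'I_n -> set R) (i : 'I_n) := if (i < t)%N then e i else q (A i).
have k0 t A i w : 0 <= k t A i w by rewrite /k; case: ifP.
have c0 t A i : 0 <= c t A i by rewrite /c; case: ifP.
have mk t A i : (forall i, measurable (A i)) -> measurable_fun setT (k t A i).
  move=> mA; rewrite /k; case: (i < t)%N; first exact: measurableT_comp.
  exact: measurableT_comp.
have m1 i : measurable_fun setT (fun w => \1_(D i) (X i w) : R).
  exact: measurableT_comp.
suff main t : (t <= n)%N -> forall A, (forall i, measurable (A i)) ->
    (\int[Pr]_w (\prod_(i < n) (\1_(D i) (X i w) * k t A i w))%:E =
     (\prod_(i < n) (p i * c t A i))%:E)%E.
  have := main n (leqnn n) (fun=> setT) (fun=> measurableT).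
  under eq_integral do under eq_bigr do rewrite /k ltn_ord.
  by under [in X in _ = X -> _]eq_bigr do rewrite /c ltn_ord.
elim: t => [_ A mA|t IH tn A mA].
  under eq_integral do rewrite /k /= big_split/= 2!prod_indic -natrM mulnb.
  pose E : set T := covariates X @^-1` [set x | forall i, D i (tnth x i)] `&`
    errors xi @^-1` [set x | forall i, A i (tnth x i)].
  have mE : measurable E.
    apply: measurableI; rewrite -[X in measurable X]setTI.
      by apply: measurable_covariates => //; exact: measurable_tuple_box.
    by apply: measurable_errors => //; exact: measurable_tuple_box.
  transitivity (\int[Pr]_w (\1_E w)%:E)%E.
    apply: eq_integral => w _; congr (_%:E); rewrite indicE; congr ((nat_of_bool _)%:R).
    apply/idP/idP => [/andP[/asboolP H /asboolP H']|].
      rewrite inE; split=> i /=; rewrite tnth_mktuple; first exact: H.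
      exact: H'.
    rewrite inE => -[/= H H']; apply/andP; split; apply/asboolP => i.
      by have := H i; rewrite tnth_mktuple.
    by have := H' i; rewrite tnth_mktuple.
  rewrite integral_indic// setIT.
  rewrite [LHS](covariate_error_indep model (measurable_tuple_box mD)
    (measurable_tuple_box mA)).
  rewrite boxX// boxxi// big_split/= EFinM -!prodE.
  by congr (_ * _)%E; apply: eq_bigr => i _; [exact: Dp|exact: (qE _ (mA i))].
pose i0 := Ordinal tn.
pose A' (B : set R) (i : 'I_n) := if i == i0 then B else A i.
have mA' B i : measurable B -> measurable (A' B i).
  by rewrite /A'; case: ifP.
pose W w := \1_(D i0) (X i0 w) *
  \prod_(i < n | i != i0) (\1_(D i) (X i w) * k t.+1 A i w).
pose v := p i0 * \prod_(i < n | i != i0) (p i * c t.+1 A i).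
have ltS i : i != i0 -> (i < t.+1)%N = (i < t)%N.
  move=> ii0; rewrite ltnS leq_eqVlt -[X in i == X :> nat]/(nat_of_ord i0).
  by rewrite (inj_eq val_inj) (negbTE ii0).
have W0 w : 0 <= W w by rewrite mulr_ge0// prodr_ge0// => i _; rewrite mulr_ge0.
have mW : measurable_fun setT W.
  apply: measurable_funM => //.
  rewrite (_ : (fun w => _) = (fun w => \prod_(i < n) (if i != i0 then
      \1_(D i) (X i w) * k t.+1 A i w else 1))); last first.
    by apply/funext => w; rewrite big_mkcond.
  apply: measurable_prod => i _; case: (i != i0) => //.
  by apply: measurable_funM => //; exact: mk.
(* Stage [t] with the set [B] put at coordinate [t] is exactly the identity on indicators that is
   needed; hence the sets [A] are quantified inside the induction. *)
have YW B : measurable B ->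
    (\int[Pr]_w (\1_B (xi i0 w) * W w)%:E = normal_prob 0 1 B * v%:E)%E.
  move=> mB; have := IH (ltnW tn) (A' B) (fun i => mA' B i mB).
  rewrite qE// -EFinM; move=> H.
  transitivity (\int[Pr]_w (\prod_(i < n) (\1_(D i) (X i w) * k t (A' B) i w))%:E)%E.
    apply: eq_integral => w _; congr (_%:E).
    rewrite [RHS](bigD1 i0)//= {1}/k ltnn /A' eqxx /W mulrCA mulrA; congr (_ * _).
    by apply: eq_bigr => i ii0; rewrite /k ltS// (negbTE ii0).
  rewrite H; congr (_%:E).
  rewrite (bigD1 i0)//= {1}/c ltnn /A' eqxx /v mulrCA mulrA; congr (_ * _).
  by apply: eq_bigr => i ii0; rewrite /c ltS// (negbTE ii0).
transitivity (\int[Pr]_w (h i0 (xi i0 w) * W w)%:E)%E.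
  apply: eq_integral => w _; congr (_%:E).
  by rewrite (bigD1 i0)//= {1}/k ltnSn /W mulrCA mulrA.
have mxi : measurable_fun setT (xi i0) by [].
rewrite [LHS](ge0_integral_weighted (mu := normal_prob 0 1) mxi mW W0 YW
  (mh i0) (h0 i0)) he -EFinM.
congr (_%:E); rewrite [RHS](bigD1 i0)//= {1}/c ltnSn /v.
by rewrite mulrAC.
Qed.

End independent_products.

(** * Means and exponential moments *)

Section mean_bounds.
Context {disp : measure_display} {T : measurableType disp} {R : realType}.
Variable Pr : probability T R.

(** Random bounds are carried by explicit measurable majorants, because the suprema that they
    dominate need not be measurable. *)
Definition mean_le (g : T -> R) (b : R) : Prop :=
  [/\ measurable_fun setT g, forall w, 0 <= g w &
      (\int[Pr]_w (g w)%:E <= b%:E)%E].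

Lemma mean_leW g b b' : b <= b' -> mean_le g b -> mean_le g b'.
Proof. by move=> bb [? ? H]; split => //; rewrite (le_trans H)// lee_fin. Qed.

Lemma mean_le_cst b : 0 <= b -> mean_le (fun=> b) b.
Proof. by move=> b0; split => //; rewrite integral_cst//= probability_setT mule1. Qed.

Lemma mean_leD g g' b b' :
  mean_le g b -> mean_le g' b' -> mean_le (fun w => g w + g' w) (b + b').
Proof.
move=> [mg g0 H] [mg' g0' H']; split.
- exact: measurable_funD.
- by move=> w; rewrite addr_ge0.
under eq_integral do rewrite EFinD.
rewrite ge0_integralD//; last 4 first.
- by move=> w _; rewrite lee_fin.
- exact/measurable_EFinP.
- by move=> w _; rewrite lee_fin.
- exact/measurable_EFinP.
by rewrite EFinD leeD.
Qed.

Lemma mean_leZ k g b : 0 <= k -> mean_le g b -> mean_le (fun w => k * g w) (k * b).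
Proof.
move=> k0 [mg g0 H]; split.
- exact: measurable_funM.
- by move=> w; rewrite mulr_ge0.
under eq_integral do rewrite EFinM.
rewrite ge0_integralZl_EFin//.
- by rewrite EFinM lee_wpmul2l.
- by move=> w _; rewrite lee_fin.
- exact/measurable_EFinP.
Qed.

Lemma mean_le_sum (I : Type) (r : seq I) (P : pred I) (g : I -> T -> R)
    (b : I -> R) :
  (forall i, P i -> mean_le (g i) (b i)) ->
  mean_le (fun w => \sum_(i <- r | P i) g i w) (\sum_(i <- r | P i) b i).
Proof.
move=> H; elim: r => [|i r IH].
  rewrite big_nil; under eq_fun do rewrite big_nil.
  exact: mean_le_cst.
rewrite big_cons; under eq_fun do rewrite big_cons.
case: ifPn => // Pi; apply: mean_leD => //; exact: H.
Qed.

End mean_bounds.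

Section gaussian_moments.
Context {R : realType}.

Lemma integral_normal_probE (h : R -> R) : measurable_fun setT h ->
  (forall x, 0 <= h x) ->
  (\int[normal_prob 0 1]_x (h x)%:E =
   \int[lebesgue_measure]_x (h x * normal_pdf 0 1 x)%:E)%E.
Proof.
move=> mh h0.
rewrite (@ge0_integral_weighted _ _ _ _ _ _ (normal_prob 0 1) id _ 1 _ _ _ _ _ mh h0).
- by rewrite mul1e.
- exact: measurable_id.
- exact: measurable_normal_pdf.
- by move=> x; exact: normal_pdf_ge0.
- move=> A mA; rewrite mule1 /normal_prob [RHS]integral_mkcond.
  apply: eq_integral => x _; rewrite patchE indicE; case: ifP => _.
    by rewrite mul1r.
  by rewrite mul0r.
Qed.

(** Exponential tilting turns the standard normal density into the one with mean [l]. *)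
Lemma normal_mgf (l : R) :
  (\int[normal_prob 0 1]_x (expR (l * x))%:E = (expR (l ^+ 2 / 2))%:E)%E.
Proof.
have ml : measurable_fun setT (fun x : R => expR (l * x)).
  by apply: measurableT_comp => //; exact: measurable_funM.
rewrite integral_normal_probE//.
transitivity (\int[lebesgue_measure]_x
    ((expR (l ^+ 2 / 2))%:E * (normal_pdf l 1 x)%:E))%E.
  apply: eq_integral => x _; rewrite -EFinM; congr (_%:E).
  rewrite !normal_pdfE ?oner_eq0// /normal_fun.
  rewrite mulrCA [RHS]mulrCA; congr (_ * _); rewrite -!expRD; congr expR.
  by field.
rewrite ge0_integralZl_EFin//.
- by rewrite integral_normal_pdf mule1.
- by move=> x _; rewrite lee_fin normal_pdf_ge0.
- by apply/measurable_EFinP; exact: measurable_normal_pdf.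
Qed.

(** Tilting by x^2/4 turns the variance 1 into 2, at the price of a factor sqrt 2, which is at most
    2. *)
Lemma normal_exp_sq_moment :
  (\int[normal_prob 0 1]_x (expR (x ^+ 2 / 4) : R)%:E <= (2 : R)%:E)%E.
Proof.
have ml : measurable_fun setT (fun x : R => expR (x ^+ 2 / 4)).
  apply: measurableT_comp => //; apply: measurable_funM => //.
rewrite integral_normal_probE//.
have s0 : Num.sqrt 2 != 0 :> R by rewrite gt_eqF// sqrtr_gt0.
rewrite (_ : (\int[_]_x _)%E = (\int[lebesgue_measure]_x
    ((Num.sqrt 2)%:E * (normal_pdf 0 (Num.sqrt 2) x)%:E))%E); last first.
  apply: eq_integral => x _; rewrite -EFinM; congr (_%:E).
  rewrite !normal_pdfE ?oner_eq0// /normal_fun.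
  rewrite mulrCA [RHS]mulrA; congr (_ * _).
    rewrite /normal_peak expr1n mul1r sqr_sqrtr// -mulrnAr [in RHS]sqrtrM// invfM.
    by rewrite mulrA divff// mul1r.
  rewrite -!expRD; congr expR; rewrite sqr_sqrtr//; by field.
rewrite ge0_integralZl_EFin//.
- rewrite integral_normal_pdf mule1 lee_fin.
  by have := @sqr_sqrtr R 2 (ler0n _ 2); have := sqrtr_ge0 (2 : R); nra.
- by move=> x _; rewrite lee_fin normal_pdf_ge0.
- by apply/measurable_EFinP; exact: measurable_normal_pdf.
Qed.

End gaussian_moments.

Section restricted_mgf.
Context {R : realType} {d n : nat} {disp : measure_display}
  {T : measurableType disp}.
Variable Pr : probability T R.
Variables (X : 'I_n -> {RV Pr >-> d.-tuple R}) (xi : 'I_n -> {RV Pr >-> R}).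
Hypothesis model : gaussian_random_design X xi.

(** Each factor is 1_D exp(phi) + 1_(complement of D). Distributing the product over the patterns
    [f] of covariates inside and outside [D], integrating, and summing back gives (1 - p + p e')^n,
    which is at most exp(n p (e - 1)). The factor [p] in the exponent is what rewards sets of small
    probability. *)
Lemma mean_le_restricted_exp (D : set (d.-tuple R)) (phi : R -> R) (p e : R) :
  measurable D -> uniform_cube d D = p%:E -> measurable_fun setT phi ->
  (\int[normal_prob 0 1]_x (expR (phi x))%:E <= e%:E)%E ->
  mean_le Pr (fun w => expR (\sum_(i < n) \1_D (X i w) * phi (xi i w)))
    (expR (n%:R * p * (e - 1))).
Proof.
move=> mD Dp mphi he.
have p0 : 0 <= p by rewrite -lee_fin -Dp.
have mephi : measurable_fun setT (fun x => expR (phi x)).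
  exact: measurableT_comp.
have m1 i : measurable_fun setT (fun w => \1_D (X i w) : R).
  exact: measurableT_comp.
split.
- apply: measurableT_comp => //; apply: measurable_sum => i.
  by apply: measurable_funM => //; exact: measurableT_comp.
- by move=> w; exact: expR_ge0.
pose D' (b : bool) := if b then D else ~` D.
pose h (b : bool) x := if b then expR (phi x) else 1.
(* The product formula needs the exact value of the moment, of which [e] is only an upper bound. *)
pose e' := fine (\int[normal_prob 0 1]_x (expR (phi x))%:E)%E.
have e'E : (\int[normal_prob 0 1]_x (expR (phi x))%:E)%E = e'%:E.
  rewrite fineK// ge0_fin_numE; first exact: le_lt_trans he (ltry _).
  by apply: integral_ge0 => x _; rewrite lee_fin expR_ge0.
have e'e : e' <= e by rewrite -lee_fin -e'E.
have mD' b : measurable (D' b) by case: b => //; exact: measurableC.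
have mh b : measurable_fun setT (h b) by rewrite /h; case: b.
have h0 b x : 0 <= h b x by case: b => //=; exact: expR_ge0.
have pD' b : uniform_cube d (D' b) = (if b then p else 1 - p)%:E.
  by case: b => //=; rewrite probability_setC// Dp.
have eh b : (\int[normal_prob 0 1]_x (h b x)%:E = (if b then e' else 1)%:E)%E.
  by case: b => //=; rewrite integral_cst//= probability_setT mule1.
have -> : (\int[Pr]_w (expR (\sum_(i < n) \1_D (X i w) * phi (xi i w)))%:E =
    \int[Pr]_w (\sum_(f : {ffun 'I_n -> bool})
      (\prod_(i < n) (\1_(D' (f i)) (X i w) * h (f i) (xi i w)))%:E))%E.
  apply: eq_integral => w _; rewrite sumEFin; congr (_%:E).
  rewrite expR_sum -(bigA_distr_bigA (fun i b => \1_(D' b) (X i w) * h b (xi i w))).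
  apply: eq_bigr => i _; rewrite big_bool /= mulr1 /D' /h /=.
  rewrite -[~` D]/(~` D) !indicE in_setC; case: (X i w \in D) => /=.
    by rewrite !mul1r addr0.
  by rewrite !mul0r add0r expR0.
rewrite ge0_integral_sum//; last 2 first.
- move=> f; apply/measurable_EFinP; apply: measurable_prod => i _.
  by apply: measurable_funM; exact: measurableT_comp.
- move=> f w _; rewrite lee_fin prodr_ge0// => i _.
  by rewrite mulr_ge0.
rewrite (eq_bigr (fun f : {ffun 'I_n -> bool} => (\prod_(i < n)
    ((if f i then p else 1 - p) * (if f i then e' else 1)))%:E)); last first.
  move=> f _; exact: (integral_prod_indep model (D := fun i => D' (f i))
    (h := fun i => h (f i)) (p := fun i => if f i then p else 1 - p)
    (e := fun i => if f i then e' else 1)).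
rewrite sumEFin lee_fin.
rewrite -(bigA_distr_bigA (fun (i : 'I_n) b =>
  (if b then p else 1 - p) * (if b then e' else 1))).
rewrite prodr_const card_ord big_bool /= mulr1.
rewrite -mulrA expRM_natl.
have e'0 : 0 <= e'.
  by rewrite -lee_fin -e'E; apply: integral_ge0 => x _; rewrite lee_fin expR_ge0.
have p1 : p <= 1 by rewrite -lee_fin -Dp; exact: probability_le1.
apply: lerXn2r; rewrite ?nnegrE ?expR_ge0//.
  by rewrite addr_ge0 ?mulr_ge0 ?subr_ge0.
apply: le_trans (expR_ge1Dx _).
have : p * e' <= p * e by rewrite ler_wpM2l.
lra.
Qed.

End restricted_mgf.

(** * Dyadic cells of the cube *)

Section dyadic_index.
Context {R : realType}.

(** The minimum puts [t = 1] into the last interval, and every real receives an index, so that the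
    cells partition the whole space and not just the cube. *)
Definition dyadic_index (j : nat) (t : R) : nat :=
  minn (Num.truncn ((2 ^ j)%:R * t)) (2 ^ j).-1.

Lemma dyadic_index_lt j t : (dyadic_index j t < 2 ^ j)%N.
Proof. by rewrite /dyadic_index; have := expn_gt0 2 j; lia. Qed.

(** Nesting of the grids: the truncation and the cap both commute with halving, the cap because half
    of 2^(j+1) - 1, rounded down, is 2^j - 1. *)
Lemma dyadic_index_half j t : dyadic_index j t = (dyadic_index j.+1 t)./2.
Proof.
have tr : Num.truncn ((2 ^ j)%:R * t) = (Num.truncn ((2 ^ j.+1)%:R * t))./2.
  have H k : (k < Num.truncn ((2 ^ j)%:R * t))%N =
      (k < (Num.truncn ((2 ^ j.+1)%:R * t))./2)%N.
    rewrite truncn_gt_nat.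
    have -> : (k < (Num.truncn ((2 ^ j.+1)%:R * t))./2)%N =
        (k.*2.+1 < Num.truncn ((2 ^ j.+1)%:R * t))%N by lia.
    rewrite truncn_gt_nat expnS natrM -mulrA -doubleS -mul2n natrM.
    by rewrite ler_pM2l.
  apply/eqP; rewrite eqn_leq; apply/andP; split; rewrite leqNgt.
    by rewrite H ltnn.
  by rewrite -H ltnn.
by rewrite /dyadic_index tr expnS; have := expn_gt0 2 j; lia.
Qed.

Lemma dyadic_index_bounds j t : 0 <= t <= 1 ->
  (dyadic_index j t)%:R / (2 ^ j)%:R <= t <= (dyadic_index j t).+1%:R / (2 ^ j)%:R.
Proof.
move=> /andP[t0 t1].
have m0 : 0 < (2 ^ j)%:R :> R by rewrite ltr0n expn_gt0.
have mt0 : 0 <= (2 ^ j)%:R * t by rewrite mulr_ge0// ltW.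
rewrite ler_pdivrMr// ler_pdivlMr// ![t * _]mulrC.
have /andP[lo hi] := truncn_itv mt0.
rewrite /dyadic_index; case: leqP => H.
  by rewrite lo ltW.
rewrite prednK ?expn_gt0//; apply/andP; split; last by rewrite ler_piMr// ltW.
by apply: le_trans lo; rewrite ler_nat ltnW.
Qed.

Lemma measurable_dyadic_index j (a : nat) :
  measurable [set t : R | dyadic_index j t = a].
Proof.
have m0 : 0 < (2 ^ j)%:R :> R by rewrite ltr0n expn_gt0.
have mge b : measurable [set t : R | (b <= dyadic_index j t)%N].
  case: b => [|b].
    by rewrite (_ : [set _ | _] = setT)//; apply/seteqP; split.
  have [bm|bm] := ltnP b (2 ^ j).-1; last first.
    rewrite (_ : [set _ | _] = set0)//; apply/seteqP; split => // t /=.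
    by rewrite /dyadic_index; lia.
  rewrite (_ : [set _ | _] = `[b.+1%:R / (2 ^ j)%:R, +oo[%classic); first exact: measurable_itv.
  apply/seteqP; split => t /=; rewrite in_itv/= andbT ler_pdivrMr// mulrC -truncn_gt_nat.
    by rewrite /dyadic_index leq_min => /andP[].
  by rewrite /dyadic_index leq_min => ->.
rewrite (_ : [set _ | _] = [set t : R | (a <= dyadic_index j t)%N] `\`
    [set t : R | (a.+1 <= dyadic_index j t)%N]); first exact: measurableD.
apply/seteqP; split => t /=; first by move=> ->; rewrite ltnn.
by move=> [H /negP]; lia.
Qed.

Lemma uniform_dyadic_index_le j (a : nat) :
  (uniform_prob (@ltr01 R) [set t : R | dyadic_index j t = a] <=
   ((2 ^ j)%:R^-1)%:E)%E.
Proof.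
have m0 : 0 < (2 ^ j)%:R :> R by rewrite ltr0n expn_gt0.
rewrite /uniform_prob integral_uniform_pdf.
pose I : set R := `[a%:R / (2 ^ j)%:R, a.+1%:R / (2 ^ j)%:R]%classic.
have muI : lebesgue_measure I = ((2 ^ j)%:R^-1)%:E.
  rewrite lebesgue_measure_itv/= lte_fin ltr_pM2r ?invr_gt0// ltr_nat ltnSn.
  by rewrite -EFinB -mulrBl -natrB// subSnn mul1r.
have mset := measurableI _ _ (measurable_dyadic_index j a) (measurable_itv `[(0:R), 1]).
set S := _ `&` _ in mset *.
have : (\int[lebesgue_measure]_(x in S) (uniform_pdf 0 1 x)%:E <=
    1%:E * lebesgue_measure S)%E.
  rewrite -integral_cst//; apply: ge0_le_integral => //.
  - by move=> x _; rewrite lee_fin uniform_pdf_ge0.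
  - by apply/measurable_EFinP/measurable_funTS; exact: measurable_uniform_pdf.
  - move=> x _; rewrite lee_fin /uniform_pdf; case: ifP => // _.
    by rewrite subr0 invr1.
move=> /le_trans; apply; rewrite mul1e -muI; apply: le_measure.
- exact: mem_set.
- by apply: mem_set; exact: measurable_itv.
move=> t [/= ta]; rewrite in_itv/= => /(dyadic_index_bounds j).
by rewrite ta /I /= in_itv/=.
Qed.

End dyadic_index.

Lemma uniform_cube_box {R : realType} d (B : 'I_d -> set R) :
  (forall k, measurable (B k)) ->
  uniform_cube d [set x | forall k, B k (tnth x k)] =
  (\prod_(k < d) uniform_prob (@ltr01 R) (B k))%E.
Proof.
elim: d B => [|d IH] B mB.
  rewrite big_ord0 /= diracE mem_set//=; by case.
rewrite big_ord_recl -(IH (fun k => B (lift ord0 k)))//.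
rewrite [LHS]/= /distribution /pushforward.
transitivity ((uniform_prob (@ltr01 R) \x uniform_cube d)%E
    (B ord0 `*` [set x | forall k, B (lift ord0 k) (tnth x k)])); last first.
  apply: product_measure1E; first exact: mB.
  exact: (measurable_tuple_box (B := fun k => B (lift ord0 k))
    (fun k => mB (lift ord0 k))).
congr (_ _); apply/seteqP; split => [[t x]/= H|[t x]/= [H0 H] k].
  split; first by have := H ord0.
  by move=> k; have := H (lift ord0 k); rewrite tnthS.
by case: (unliftP ord0 k) => [i ->|->//]; rewrite tnthS.
Qed.

Lemma uniform_unit_cube {R : realType} d :
  uniform_cube d (@unit_cube R d) = 1%E.
Proof.
rewrite (_ : unit_cube = [set x : d.-tuple R | forall k, `[0, 1]%classic (tnth x k)]).
  rewrite (uniform_cube_box (B := fun=> `[0, 1]%classic))//.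
  by rewrite big1// => k _; rewrite /uniform_prob integral_uniform_pdf1.
by apply/seteqP; split => x /= H k; have := H k; rewrite in_itv.
Qed.

Lemma measurable_unit_cube {R : realType} d : measurable (@unit_cube R d).
Proof.
rewrite (_ : unit_cube = [set x : d.-tuple R | forall k, `[0, 1]%classic (tnth x k)]).
  apply: (measurable_tuple_box (B := fun=> [set t : R | t \in `[0, 1]])) => k.
  exact: measurable_itv.
by apply/seteqP; split => x /= H k; have := H k; rewrite in_itv.
Qed.

Section dyadic_cells.
Context {R : realType} {d : nat}.
Implicit Types (j : nat) (x : d.-tuple R).

Definition dyadic_cell j x : cell d (2 ^ j) :=
  [ffun k => Ordinal (dyadic_index_lt j (tnth x k))].

Definition low_corner j (c : cell d (2 ^ j)) : d.-tuple R :=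
  [tuple (c k)%:R / (2 ^ j)%:R | k < d].

Definition up_corner j (c : cell d (2 ^ j)) : d.-tuple R :=
  [tuple (c k).+1%:R / (2 ^ j)%:R | k < d].

Lemma measurable_dyadic_cell j c : measurable [set x | dyadic_cell j x = c].
Proof.
rewrite (_ : [set x | _] =
    [set x | forall k, [set t : R | dyadic_index j t = c k] (tnth x k)]).
  apply: (measurable_tuple_box (B := fun k => [set t : R | dyadic_index j t = c k])).
  by move=> k; exact: measurable_dyadic_index.
apply/seteqP; split => x /= H; first by move=> k; rewrite -H ffunE.
by apply/ffunP => k; rewrite ffunE; apply: val_inj; rewrite /= H.
Qed.

Lemma measurable_dyadic_cells j (D : {set cell d (2 ^ j)}) :
  measurable [set x | dyadic_cell j x \in D].
Proof.
rewrite (_ : [set x | _] = \bigcup_(c in [set` D]) [set x | dyadic_cell j x = c]).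
  by apply: fin_bigcup_measurable => // c _; exact: measurable_dyadic_cell.
by apply/seteqP; split => x /=; [exists (dyadic_cell j x)|move=> [c /= + ->]].
Qed.

Lemma uniform_dyadic_cell_le j c :
  (uniform_cube d [set x | dyadic_cell j x = c] <= ((2 ^ j)%:R ^- d)%:E)%E.
Proof.
rewrite (_ : [set x | _] =
    [set x | forall k, [set t : R | dyadic_index j t = c k] (tnth x k)]); last first.
  apply/seteqP; split => x /= H; first by move=> k; rewrite -H ffunE.
  by apply/ffunP => k; rewrite ffunE; apply: val_inj; rewrite /= H.
rewrite (uniform_cube_box (B := fun k => [set t : R | dyadic_index j t = c k]));
  last by move=> k; exact: measurable_dyadic_index.
rewrite -exprVn -[X in _ ^+ X]card_ord -prodr_const.
set p := (\prod_(k < d) _)%E; set q := \prod_(k in 'I_d) _.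
suff /andP[] : (0 <= p <= q%:E)%E by [].
rewrite /p /q; elim/big_rec2: _ => [|k y z _ /andP[z0 zy]].
  by rewrite lee01 lexx.
rewrite mule_ge0//= EFinM lee_pmul//.
exact: uniform_dyadic_index_le.
Qed.

End dyadic_cells.

(** * Inner approximation of an upper set by dyadic cells *)

Section corners.
Context {R : realType} {d : nat}.
Implicit Types (j : nat) (x y : d.-tuple R).

Lemma low_corner_cube j (c : cell d (2 ^ j)) : unit_cube (low_corner (R := R) c).
Proof.
move=> k; rewrite tnth_mktuple divr_ge0//= ler_pdivrMr ?ltr0n ?expn_gt0// mul1r.
by rewrite ler_nat ltnW.
Qed.

Lemma up_corner_cube j (c : cell d (2 ^ j)) : unit_cube (up_corner (R := R) c).
Proof.
move=> k; rewrite tnth_mktuple divr_ge0//= ler_pdivrMr ?ltr0n ?expn_gt0// mul1r.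
by rewrite ler_nat.
Qed.

Lemma low_corner_le j x : unit_cube x -> le_coord (low_corner (dyadic_cell j x)) x.
Proof.
by move=> cx k; rewrite tnth_mktuple ffunE; case/andP: (dyadic_index_bounds j (cx k)).
Qed.

Lemma up_corner_ge j x : unit_cube x -> le_coord x (up_corner (dyadic_cell j x)).
Proof.
by move=> cx k; rewrite tnth_mktuple ffunE; case/andP: (dyadic_index_bounds j (cx k)).
Qed.

Lemma low_corner_mono j (c c' : cell d (2 ^ j)) :
  cell_le c c' -> le_coord (low_corner (R := R) c) (low_corner c').
Proof.
move=> /forallP cc k; rewrite !tnth_mktuple ler_pM2r ?invr_gt0 ?ltr0n ?expn_gt0//.
by rewrite ler_nat.
Qed.

Lemma diag_succ_corner j (c c' : cell d (2 ^ j)) :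
  diag_succ c c' -> up_corner (R := R) c = low_corner c'.
Proof.
move=> /forallP cc; apply: eq_from_tnth => k; rewrite !tnth_mktuple.
by rewrite (eqP (cc k)).
Qed.

Section pattern.
Variable U : d.-tuple R -> bool.
Hypothesis monoU : forall x y, unit_cube x -> unit_cube y -> le_coord x y ->
  U x -> U y.

(** By monotonicity these are the cells whose points in the cube all belong to [U]. *)
Definition pattern j : {set cell d (2 ^ j)} := [set c | U (low_corner c)]%SET.

Lemma pattern_upset j : pattern j \in upsets d (2 ^ j).
Proof.
apply/upsetP => c c'; rewrite !inE => Uc cc'.
by apply: monoU Uc; [exact: low_corner_cube..|exact: low_corner_mono].
Qed.

Lemma pattern_sub j x : unit_cube x -> dyadic_cell j x \in pattern j -> U x.
Proof.
move=> cx; rewrite inE; apply: monoU => //; first exact: low_corner_cube.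
exact: low_corner_le.
Qed.

(** A cell that meets [U] inside the cube has its upper corner in [U], so these are all the cells on
    which [U] and its inner approximation can differ. If the cell has a diagonal successor, the
    lower corner of that successor is the upper corner in question; if not, the cell is in a top
    face. *)
Lemma up_corner_boundary j (c : cell d (2 ^ j)) : U (up_corner c) ->
  (c \in pattern j) || (c \in upper_boundary (pattern j)).
Proof.
move=> Uc; rewrite /upper_boundary finset.in_setU; have [//|cg /=] := boolP (c \in pattern j).
rewrite [X in _ || X]inE.
have [_|/diag_succ_ex[c' cc']] := boolP [exists k, c k == (2 ^ j).-1 :> nat].
  by rewrite orbT.
rewrite orbF inE; apply/andP; split; first by rewrite inE.
by apply/existsP; exists c'; rewrite cc' andbT inE -(diag_succ_corner cc').
Qed.

End pattern.

End corners.

(** * Links of the chain between consecutive grids *)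

Section chain_sets.
Variables (d m : nat).

Lemma even_floor_subproof (a : 'I_m) : ((a./2).*2 < m)%N.
Proof. by have := ltn_ord a; lia. Qed.

(** On dyadic grids this cell shares its lower corner with the coarse cell containing [c]. The
    coarse pattern can thus be read off the fine one, and a link depends on a single upset, so that
    counting upsets counts links. *)
Definition even_floor (c : cell d m) : cell d m :=
  [ffun k => Ordinal (even_floor_subproof (c k))].

(* The difference between the inner approximations of an upset on the grid of
   mesh [1/m] and on the twice coarser one; at the coarsest level the whole
   upset. *)
Definition chain_set (g : {set cell d m}) : {set cell d m} :=
  if (m <= 1)%N then g else [set c in g | even_floor c \notin g]%SET.

(** Rounding down to an even index moves it by at most one, so the diagonal predecessor of [c] is
    below [even_floor c] and therefore outside [g]: the link lies in [lower_boundary g]. When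
    [m <= 1] there is at most one cell. *)
Lemma card_chain_set (g : {set cell d m}) : (0 < d)%N -> g \in upsets d m ->
  (#|chain_set g| <= 2 * d * m ^ d.-1)%N.
Proof.
move=> d0 ug; rewrite /chain_set; have [m1|m1] := leqP m 1.
  apply: leq_trans (max_card _) _; rewrite card_cell.
  case: m m1 => [|[|//]] _; first by rewrite exp0n.
  by rewrite !exp1n; lia.
apply: leq_trans (card_lower_boundary ug); apply/subset_leq_card/fintype.subsetP => c.
rewrite inE => /andP[cg eg]; rewrite /lower_boundary finset.in_setU [X in _ || X]inE.
have [_|/diag_pred_ex[e ec]] := boolP [exists k, c k == 0%N :> nat]; first by rewrite orbT.
rewrite orbF inE cg /=; apply/existsP; exists e; rewrite ec andbT finset.in_setC.
apply: contra eg => /(upsetP _ ug); apply; apply/forallP => k.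
by rewrite ffunE /=; have /forallP/(_ k) := ec; lia.
Qed.

End chain_sets.

Section telescope.
Context {R : realType} {d : nat}.
Variable U : d.-tuple R -> bool.
Hypothesis monoU : forall x y, unit_cube x -> unit_cube y -> le_coord x y ->
  U x -> U y.

Lemma low_corner_even_floor j (x : d.-tuple R) :
  low_corner (even_floor (dyadic_cell j.+1 x)) = low_corner (dyadic_cell j x) :> d.-tuple R.
Proof.
apply: eq_from_tnth => k; rewrite !tnth_mktuple !ffunE /= -dyadic_index_half.
rewrite expnS -mul2n !natrM invfM mulrACA divff ?mul1r//.
Qed.

Lemma pattern_step j (x : d.-tuple R) :
  (dyadic_cell j.+1 x \in pattern U j.+1)%:R =
  (dyadic_cell j x \in pattern U j)%:R +
  (dyadic_cell j.+1 x \in chain_set (pattern U j.+1))%:R :> R.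
Proof.
set c := dyadic_cell j.+1 x.
have E : (dyadic_cell j x \in pattern U j) = (even_floor c \in pattern U j.+1).
  by rewrite !inE low_corner_even_floor.
have le : cell_le (even_floor c) c.
  by apply/forallP => k; rewrite [in leqLHS]ffunE /=; lia.
rewrite E /chain_set ifF; last first.
  by rewrite expnS; have := expn_gt0 2 j; lia.
rewrite [X in _ = _ + (nat_of_bool X)%:R]inE.
case: (boolP (even_floor c \in _)) => [ec|_]; last by rewrite /= andbT add0r.
by rewrite (upsetP _ (pattern_upset monoU _) _ _ ec le) /= addr0.
Qed.

Lemma pattern_telescope J (x : d.-tuple R) :
  (dyadic_cell J x \in pattern U J)%:R =
  \sum_(j < J.+1) (dyadic_cell j x \in chain_set (pattern U j))%:R :> R.
Proof.
elim: J => [|J IH]; last by rewrite big_ord_recr/= -IH pattern_step.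
by rewrite big_ord_recr/= big_ord0 add0r.
Qed.

End telescope.

(** * Maximal inequality and chaining *)

Section maximal_inequality.
Context {disp : measure_display} {T : measurableType disp} {R : realType}.
Variable Pr : probability T R.

Lemma mean_le_mono (g g' : T -> R) b : measurable_fun setT g' ->
  (forall w, 0 <= g' w <= g w) -> mean_le Pr g b -> mean_le Pr g' b.
Proof.
move=> mg' gg' [mg g0 H]; split => //; first by move=> w; case/andP: (gg' w).
apply: le_trans H; apply: ge0_le_integral => //.
- by move=> w _; rewrite lee_fin; case/andP: (gg' w).
- exact/measurable_EFinP.
- exact/measurable_EFinP.
- by move=> w _; rewrite lee_fin; case/andP: (gg' w).
Qed.

(* Averaging [t <= a + exp (t - a)] avoids Jensen's inequality. *)
Lemma mean_le_max (I : finType) (A : {set I}) (Z : I -> T -> R) (l a B : R) :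
  0 < l -> 0 <= a -> #|A|%:R * B <= expR a ->
  (forall i, i \in A -> mean_le Pr (fun w => expR (l * Z i w)) B) ->
  exists G : T -> R, mean_le Pr G ((a + 1) / l) /\
    forall i w, i \in A -> Z i w <= G w.
Proof.
move=> l0 a0 AB ZB.
(* The one exponential that is needed is majorized by the sum over [A], whose mean is at most
   [expR a]; hence the [+ 1] in the bound. *)
exists (fun w => l^-1 * (a + expR (- a) * \sum_(i in A) expR (l * Z i w))); split.
  rewrite mulrC; apply: mean_leZ; first by rewrite invr_ge0 ltW.
  apply: mean_leD; first exact: mean_le_cst.
  apply: (@mean_leW _ _ _ _ _ (expR (- a) * \sum_(i in A) B)); last first.
    by apply: mean_leZ; [exact: expR_ge0|exact: mean_le_sum].
  rewrite sumr_const -mulr_natl -(@ler_pM2l _ (expR a)) ?expR_gt0//.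
  by rewrite !mulrA -expRD subrr expR0 mul1r mulr1.
move=> i w iA; rewrite -(@ler_pM2l _ l)// mulrA divff ?gt_eqF// mul1r.
apply: (@le_trans _ _ (a + expR (- a) * expR (l * Z i w))).
  by rewrite -expRD; have := @expR_ge1Dx R (- a + l * Z i w); lra.
rewrite lerD2l ler_pM2l ?expR_gt0// (bigD1 i)//= lerDl sumr_ge0// => k _.
Qed.

End maximal_inequality.

(** * Probabilities of unions of cells *)

Section cell_probabilities.
Context {R : realType} {d : nat}.

Definition cell_prob j (D : {set cell d (2 ^ j)}) : R :=
  fine (@uniform_cube R d [set x | dyadic_cell j x \in D]).

Lemma uniform_cells j (D : {set cell d (2 ^ j)}) :
  uniform_cube d [set x | dyadic_cell j x \in D] = (cell_prob D)%:E.
Proof. by rewrite fineK// fin_num_measure//; exact: measurable_dyadic_cells. Qed.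

Lemma cell_prob_ge0 j (D : {set cell d (2 ^ j)}) : 0 <= cell_prob D.
Proof. by rewrite fine_ge0. Qed.

Lemma cell_probE j (D : {set cell d (2 ^ j)}) :
  (\int[uniform_cube d]_x ((dyadic_cell j x \in D)%:R)%:E)%E = (cell_prob D)%:E.
Proof.
rewrite -uniform_cells -[X in uniform_cube d X]setIT -integral_indic//; last first.
  exact: measurable_dyadic_cells.
apply: eq_integral => x _; rewrite indicE; congr ((nat_of_bool _)%:R%:E).
by apply/idP/idP; rewrite inE.
Qed.

Lemma measurable_mem_cells j (D : {set cell d (2 ^ j)}) :
  measurable_fun setT (fun x : d.-tuple R => (dyadic_cell j x \in D)%:R : R).
Proof.
rewrite (_ : (fun x => _) = \1_[set x : d.-tuple R | dyadic_cell j x \in D]).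
  by apply: measurable_indic; exact: measurable_dyadic_cells.
apply/funext => x; rewrite indicE; congr ((nat_of_bool _)%:R).
by apply/idP/idP; rewrite inE.
Qed.

Lemma cell_prob_sum j (D : {set cell d (2 ^ j)}) :
  cell_prob D = \sum_(c in D) cell_prob [set c].
Proof.
apply: EFin_inj; rewrite -cell_probE -sumEFin.
under [RHS]eq_bigr do rewrite -cell_probE.
rewrite -[RHS]big_enum/= -ge0_integral_sum//; last 1 first.
- by move=> c; apply/measurable_EFinP; exact: measurable_mem_cells.
apply: eq_integral => x _; rewrite sumEFin big_enum/=; congr (_%:E).
set c := dyadic_cell j x.
have [cD|cD] := boolP (c \in D).
  rewrite (bigD1 c)//= finset.inE eqxx big1 ?addr0// => e /andP[_ ec].
  by rewrite finset.inE eq_sym (negbTE ec).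
rewrite big1// => e eD; rewrite finset.inE.
by case: eqP => // ce; rewrite ce eD in cD.
Qed.

Lemma cell_prob_setT j : cell_prob [set: cell d (2 ^ j)] = 1.
Proof.
apply: EFin_inj; rewrite -uniform_cells (_ : [set x | _] = setT).
  exact: probability_setT.
by apply/seteqP; split => x _ //=; rewrite finset.inE.
Qed.

Lemma cell_prob_le j (D : {set cell d (2 ^ j)}) :
  cell_prob D <= #|D|%:R / (2 ^ j)%:R ^+ d.
Proof.
rewrite cell_prob_sum mulr_natl -sumr_const; apply: ler_sum => c _.
rewrite -lee_fin -uniform_cells (_ : [set x | _] = [set x | dyadic_cell j x = c]).
  exact: uniform_dyadic_cell_le.
by apply/seteqP; split => x /=; rewrite finset.inE => /eqP.
Qed.

Lemma cell_prob_boundary_le j (D : {set cell d (2 ^ j)}) : (0 < d)%N ->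
  (#|D| <= 2 * d * (2 ^ j) ^ d.-1)%N -> cell_prob D <= 2 * d%:R / (2 ^ j)%:R.
Proof.
move=> d0 HD; apply: le_trans (cell_prob_le D) _.
have m0 : 0 < (2 ^ j)%:R :> R by rewrite ltr0n expn_gt0.
rewrite ler_pdivrMr ?exprn_gt0// -[in X in _ ^+ X](prednK d0) exprS mulrA divfK ?gt_eqF//.
by rewrite -natrX -!natrM ler_nat.
Qed.

Lemma cell_probS j (D D' : {set cell d (2 ^ j)}) :
  D \subset D' -> cell_prob D <= cell_prob D'.
Proof.
move=> /fintype.subsetP DD; rewrite -lee_fin -!uniform_cells; apply: le_measure.
- by apply: mem_set; exact: measurable_dyadic_cells.
- by apply: mem_set; exact: measurable_dyadic_cells.
- by move=> x /=; exact: DD.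
Qed.

Lemma cell_probU_le j (D D' : {set cell d (2 ^ j)}) :
  cell_prob (D :|: D')%SET <= cell_prob D + cell_prob D'.
Proof.
rewrite !cell_prob_sum !(big_mkcond (fun c => c \in _)) -big_split/=.
apply: ler_sum => c _; rewrite finset.in_setU.
have := cell_prob_ge0 [set c]%SET.
by case: (c \in D); case: (c \in D') => /=; lra.
Qed.

Lemma cell_prob_telescope (U : d.-tuple R -> bool) J :
  (forall x y, unit_cube x -> unit_cube y -> le_coord x y -> U x -> U y) ->
  cell_prob (pattern U J) = \sum_(j < J.+1) cell_prob (chain_set (pattern U j)).
Proof.
move=> mU; apply: EFin_inj; rewrite -cell_probE -sumEFin.
under [RHS]eq_bigr do rewrite -cell_probE.
rewrite -ge0_integral_sum//; last 1 first.
- by move=> j; apply/measurable_EFinP; exact: measurable_mem_cells.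
by apply: eq_integral => x _; rewrite sumEFin (pattern_telescope mU).
Qed.

End cell_probabilities.

Lemma card_upsets_expR {R : realType} d m : (1 < d)%N ->
  #|upsets d m|%:R <= expR (2 * (m ^ d.-1)%:R) :> R.
Proof.
case: d => [|[|d]]// _; apply: (@le_trans _ _ ((4 ^ (m ^ d.+1))%:R)).
  by rewrite ler_nat; exact: card_upsets.
rewrite mulrC expRM_natl natrX; apply: lerXn2r; rewrite ?nnegrE ?expR_ge0//.
have e1 : 2 <= expR 1 :> R by have := @expR_ge1Dx R 1; lra.
have -> : (2 : R) = 1 + 1 by lra.
by rewrite expRD; nra.
Qed.

(** * Chaining for the empirical and the multiplier process at once *)

Section process.
Context {R : realType} {d n : nat} {disp : measure_display}
  {T : measurableType disp}.
Variable Pr : probability T R.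
Variables (X : 'I_n -> {RV Pr >-> d.-tuple R}) (xi : 'I_n -> {RV Pr >-> R}).
Hypothesis model : gaussian_random_design X xi.
Hypotheses (d2 : (1 < d)%N) (n0 : (0 < n)%N).
Variables (phi : R -> R) (mphi : R).
Hypothesis mphi_fun : measurable_fun setT phi.
Hypothesis phi_mgf : forall l : R, -1 <= l <= 1 ->
  (\int[normal_prob 0 1]_x (expR (l * phi x))%:E <= (1 + l * mphi + 2 * l ^+ 2)%:E)%E.
Hypothesis phi_abs : (\int[normal_prob 0 1]_x (expR `|phi x|)%:E <= 4%:E)%E.

(** Here [mphi] plays the role of the mean of [phi]: the constant 1 with [mphi = 1] gives the
    empirical process, the identity with [mphi = 0] the multiplier process. *)
Definition centered_sum j (D : {set cell d (2 ^ j)}) (w : T) : R :=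
  \sum_(i < n) (dyadic_cell j (X i w) \in D)%:R * phi (xi i w) -
  n%:R * mphi * cell_prob D.

Let indic_cells j (D : {set cell d (2 ^ j)}) (x : d.-tuple R) :
  (dyadic_cell j x \in D)%:R = \1_[set x | dyadic_cell j x \in D] x :> R.
Proof.
by rewrite indicE; congr ((nat_of_bool _)%:R); apply/idP/idP; rewrite inE.
Qed.

Lemma measurable_mem_cells_X j (D : {set cell d (2 ^ j)}) (i : 'I_n) :
  measurable_fun setT (fun w => (dyadic_cell j (X i w) \in D)%:R : R).
Proof.
have mX : measurable_fun setT (X i) by [].
exact: (measurableT_comp (measurable_mem_cells D) mX).
Qed.

Lemma measurable_centered_sum j (D : {set cell d (2 ^ j)}) :
  measurable_fun setT (centered_sum D).
Proof.
apply: measurable_funB => //; apply: measurable_sum => i.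
by apply: measurable_funM; [exact: measurable_mem_cells_X|exact: measurableT_comp].
Qed.

(** A Bernstein-type estimate: the centring cancels the linear term of the exponent, and what is
    left is proportional to the probability of [D]. *)
Lemma centered_sum_mgf j (D : {set cell d (2 ^ j)}) (l : R) : -1 <= l <= 1 ->
  mean_le Pr (fun w => expR (l * centered_sum D w))
    (expR (n%:R * cell_prob D * (2 * l ^+ 2))).
Proof.
move=> l1.
have := mean_le_restricted_exp model (measurable_dyadic_cells D) (uniform_cells D)
  (measurable_funM (measurable_cst l) mphi_fun) (phi_mgf l1).
move=> /(mean_leZ (expR_ge0 (- (l * (n%:R * mphi * cell_prob D))))).
rewrite (_ : n%:R * cell_prob D * (2 * l ^+ 2) = - (l * (n%:R * mphi * cell_prob D)) +
  n%:R * cell_prob D * (1 + l * mphi + 2 * l ^+ 2 - 1)); last by ring.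
rewrite expRD.
congr (mean_le _ _ _); apply/funext => w /=; rewrite -expRD; congr expR.
rewrite /centered_sum mulrBr addrC; congr (_ - _); rewrite mulr_sumr.
by apply: eq_bigr => i _; rewrite indic_cells /= mulrCA.
Qed.

Lemma chain_level j : (2 ^ (j * d) <= n)%N ->
  exists G : T -> R,
    mean_le Pr G ((4 + 4 * d%:R) * Num.sqrt (n * 2 ^ (j * (d - 2)))%:R) /\
    forall (g : {set cell d (2 ^ j)}) w, g \in upsets d (2 ^ j) ->
      `|centered_sum (chain_set g) w| <= G w.
Proof.
move=> jn; set m := (2 ^ j)%N.
have nR : 0 < n%:R :> R by rewrite ltr0n.
have mdE : (m ^ d)%N = (2 ^ (j * d))%N by rewrite -expnM.
have md0 : 0 < (m ^ d)%:R :> R by rewrite ltr0n !expn_gt0.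
(* With a link of probability at most 2d/m this makes the exponent n (2d/m) 2 l^2 equal to 4d
   m^(d-1), comparable to the logarithm of the number of upsets. *)
pose l := Num.sqrt ((m ^ d)%:R / n%:R) : R.
have l0 : 0 < l by rewrite sqrtr_gt0 divr_gt0.
have l2 : l ^+ 2 = (m ^ d)%:R / n%:R by rewrite sqr_sqrtr// divr_ge0.
have l1 : l <= 1.
  by rewrite -(@ler_pXn2r _ 2)// ?nnegrE ?(ltW l0)// expr1n l2 ler_pdivrMr// mul1r ler_nat mdE.
set M : R := (m ^ d.-1)%:R.
have M1 : 1 <= M by rewrite ler1n !expn_gt0.
have d1 : (0 < d)%N by exact: ltnW.
have dMm : (m ^ d)%:R = M * m%:R :> R by rewrite -natrM -expnSr prednK.
have m0 : 0 < m%:R :> R by rewrite ltr0n expn_gt0.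
(* Here 2M pays for the number of upsets, 4dM for the exponential moment, and the last M for the
   factor 2 coming from the two signs of the centred sum. *)
pose a := (3 + 4 * d%:R) * M.
have [||||G [mG GZ]] := @mean_le_max _ _ _ Pr {set cell d m} (upsets d m)
  (fun g w => `|centered_sum (chain_set g) w|) l a (2 * expR (4 * d%:R * M)).
- exact: l0.
- by rewrite mulr_ge0//; lra.
- have -> : a = 2 * M + (M + 4 * d%:R * M) by rewrite /a; ring.
  rewrite !expRD; apply: ler_pM; rewrite ?mulr_ge0 ?expR_ge0 ?card_upsets_expR//.
  rewrite ler_pM2r ?expR_gt0//; have := @expR_ge1Dx R M; lra.
- move=> g ug.
  have H (s : R) : -1 <= s <= 1 -> s ^+ 2 = l ^+ 2 ->
      mean_le Pr (fun w => expR (s * centered_sum (chain_set g) w)) (expR (4 * d%:R * M)).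
    move=> s1 sl; apply: mean_leW (centered_sum_mgf (chain_set g) s1).
    rewrite ler_expR sl l2.
    have := cell_prob_boundary_le d1 (card_chain_set d1 ug) (R := R).
    rewrite -/m => Hp.
    apply: (@le_trans _ _ (n%:R * (2 * d%:R / m%:R) * (2 * ((m ^ d)%:R / n%:R)))).
      by rewrite ler_wpM2r ?mulr_ge0 ?divr_ge0// ler_wpM2l.
    rewrite dMm le_eqVlt; apply/orP; left; apply/eqP.
    by field; rewrite !gt_eqF.
  have ll : -1 <= l <= 1 by apply/andP; split; lra.
  have Nll : -1 <= - l <= 1 by apply/andP; split; lra.
  have := mean_leD (H l ll erefl) (H (- l) Nll (sqrrN _)).
  have -> : expR (4 * d%:R * M) + expR (4 * d%:R * M) = 2 * expR (4 * d%:R * M) by ring.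
  move=> HH; apply: mean_le_mono HH.
  + apply: measurableT_comp => //; apply: measurable_funM => //.
    by apply: measurableT_comp => //; exact: measurable_centered_sum.
  + move=> w; rewrite expR_ge0/=; case: ger0P => _.
      by rewrite lerDl expR_ge0.
    by rewrite mulrN -mulNr lerDr expR_ge0.
exists G; split; last by move=> g w ug; exact: GZ.
apply: mean_leW mG.
have -> : Num.sqrt (n * 2 ^ (j * (d - 2)))%:R = M / l :> R.
  rewrite -[RHS]ger0_norm ?divr_ge0 ?(ltW l0)// -sqrtr_sqr; congr Num.sqrt.
  rewrite expr_div_n l2 natrM.
  have -> : (2 ^ (j * (d - 2)))%N = (m ^ (d - 2))%N by rewrite -expnM.
  rewrite dMm.
  have -> : M = (m ^ (d - 2))%:R * m%:R.
    by rewrite -natrM -expnSr /M; congr (_ ^ _)%:R; lia.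
  by field; rewrite !gt_eqF// ltr0n !expn_gt0.
rewrite mulrA ler_pM2r ?invr_gt0// /a; lra.
Qed.

(** No cancellation is sought in the boundary cells: absolute values are summed and the exponential
    parameter is 1. With N = n/2^J, the exponential moment costs (4 - 1) 2d N = 6dN, and 2^(J d) <=
    n keeps the entropy at most 2N. *)
Lemma boundary_level J : (2 ^ (J * d) <= n)%N ->
  exists G : T -> R,
    mean_le Pr G ((3 + 6 * d%:R) * (n%:R / (2 ^ J)%:R)) /\
    forall (g : {set cell d (2 ^ J)}) w, g \in upsets d (2 ^ J) ->
      \sum_(i < n) (dyadic_cell J (X i w) \in upper_boundary g)%:R * `|phi (xi i w)|
      <= G w.
Proof.
move=> Jn; set m := (2 ^ J)%N; set N : R := n%:R / m%:R.
have d1 : (0 < d)%N by exact: ltnW.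
have m0 : 0 < m%:R :> R by rewrite ltr0n expn_gt0.
have mN : (m ^ d.-1)%:R <= N.
  rewrite /N ler_pdivlMr// -natrM -expnSr prednK// ler_nat.
  by rewrite /m -expnM.
have N1 : 1 <= N by apply: le_trans mN; rewrite ler1n !expn_gt0.
have mabs : measurable_fun setT (fun x => `|phi x|) by exact: measurableT_comp.
have [||||G [mG GT]] := @mean_le_max _ _ _ Pr {set cell d m} (upsets d m)
  (fun g w => \sum_(i < n) (dyadic_cell J (X i w) \in upper_boundary g)%:R *
     `|phi (xi i w)|) 1 ((2 + 6 * d%:R) * N) (expR (6 * d%:R * N)).
- by [].
- by have dd := ler0n R d; rewrite mulr_ge0//; lra.
- rewrite (_ : (2 + 6 * d%:R) * N = 2 * N + 6 * d%:R * N); last by ring.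
  rewrite expRD ler_pM2r ?expR_gt0//.
  by apply: le_trans (card_upsets_expR _ d2) _; rewrite ler_expR ler_pM2l.
- move=> g ug.
  have := mean_le_restricted_exp model (measurable_dyadic_cells (upper_boundary g))
    (uniform_cells _) mabs phi_abs.
  set f := (X in mean_le _ X); set f' := (X in _ -> mean_le _ X _).
  have -> : f = f'.
    apply/funext => w; rewrite /f /f' mul1r; congr expR.
    by apply: eq_bigr => i _; rewrite indic_cells.
  apply: mean_leW; rewrite ler_expR.
  have := cell_prob_boundary_le d1 (card_upper_boundary ug) (R := R).
  rewrite -/m => /(ler_wpM2l (ler0n R n)).
  have -> : n%:R * (2 * d%:R / m%:R) = 2 * d%:R * N :> R.
    by rewrite /N; field; rewrite gt_eqF.
  lra.
exists G; split; last by move=> g w ug; exact: GT.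
by apply: mean_leW mG; rewrite divr1; lra.
Qed.

(** For d >= 3 the levels grow by a factor of at least sqrt 2, and 4 exceeds the geometric sum 1/(1
    - 2^(-1/2)). *)
Let kappa J : R := if d == 2 then J.+1%:R else 4.

Lemma sum_levels J : (2 ^ (J * d) <= n)%N ->
  \sum_(j < J.+1) Num.sqrt (n * 2 ^ (j * (d - 2)))%:R <=
  kappa J * (n%:R / (2 ^ J)%:R).
Proof.
move=> Jn; pose s j : R := Num.sqrt (n * 2 ^ (j * (d - 2)))%:R.
have s0 j : 0 <= s j by exact: sqrtr_ge0.
have m0 : 0 < (2 ^ J)%:R :> R by rewrite ltr0n expn_gt0.
have sJ : s J <= n%:R / (2 ^ J)%:R.
  rewrite -[leRHS]ger0_norm ?divr_ge0// -sqrtr_sqr ler_wsqrtr//.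
  rewrite expr_div_n ler_pdivlMr ?exprn_gt0// -!natrX -natrM ler_nat.
  by rewrite -mulnA -expnM -expnD -mulnDr subnK// -mulnn leq_mul2l Jn orbT.
rewrite /kappa; have [dE|dN] := eqVneq d 2.
  rewrite (eq_bigr (fun=> s J)); last first.
    by move=> j _; rewrite /s dE subnn !muln0.
  by rewrite sumr_const card_ord -[leLHS]mulr_natl ler_wpM2l.
apply: (@le_trans _ _ (4 * s J)); last by rewrite ler_wpM2l.
(* The ratio sqrt 2, stated through squares, exceeds 4/3; this gives [4 * s J <= 3 * s J.+1], as the
   induction requires. *)
have step j : 2 * s j ^+ 2 <= s j.+1 ^+ 2.
  rewrite !sqr_sqrtr// -[2]/(2%:R) -natrM ler_nat mulnCA leq_mul2l -expnS leq_exp2l//.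
  have d3 : (2 < d)%N by lia.
  by rewrite ltn_mul2r ltnSn andbT subn_gt0 d3 orbT.
elim: J {Jn m0 sJ} => [|J IH].
  by rewrite big_ord_recr big_ord0/= add0r -/(s 0%N); have := s0 0%N; lra.
rewrite big_ord_recr/= -/(s J.+1); have := step J; have := s0 J; have := s0 J.+1.
have [h|h] := lerP (4 * s J) (3 * s J.+1); first by move: IH; lra.
by nra.
Qed.

Lemma process_bound J : (2 ^ (J * d) <= n)%N ->
  exists G : T -> R,
    mean_le Pr G ((7 + 10 * d%:R) * kappa J * (n%:R / (2 ^ J)%:R)) /\
    forall (U : d.-tuple R -> bool) w,
      (forall x y, unit_cube x -> unit_cube y -> le_coord x y -> U x -> U y) ->
      (forall i, unit_cube (X i w)) ->
      `|\sum_(i < n) (U (X i w))%:R * phi (xi i w) -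
        n%:R * mphi * cell_prob (pattern U J)| <= G w.
Proof.
move=> Jn.
have lev (j : 'I_J.+1) : exists G : T -> R,
    mean_le Pr G ((4 + 4 * d%:R) * Num.sqrt (n * 2 ^ (j * (d - 2)))%:R) /\
    forall (g : {set cell d (2 ^ j)}) w, g \in upsets d (2 ^ j) ->
      `|centered_sum (chain_set g) w| <= G w.
  apply: chain_level; apply: leq_trans Jn; rewrite leq_exp2l// leq_mul2r.
  by rewrite -ltnS ltn_ord orbT.
have [G GP] := choice lev; have [B [mB BP]] := boundary_level Jn.
exists (fun w => \sum_(j < J.+1) G j w + B w); split.
  have := mean_leD (mean_le_sum (index_enum _) (P := xpredT) (fun j _ => (GP j).1)) mB.
  apply: mean_leW; rewrite -mulr_sumr.
  have N0 : 0 <= n%:R / (2 ^ J)%:R :> R by rewrite divr_ge0.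
  have k1 : 1 <= kappa J by rewrite /kappa; case: ifP => _; rewrite ?ler1n.
  have := sum_levels Jn; have := ler0n R d.
  set S := \sum_(j < _) _; set N := n%:R / _ in N0 *; set k := kappa J in k1 *.
  move=> dd0 Sk.
  have : (4 + 4 * d%:R) * S <= (4 + 4 * d%:R) * (k * N) by apply: ler_wpM2l => //; lra.
  have : (3 + 6 * d%:R) * N <= (3 + 6 * d%:R) * (k * N).
    by apply: ler_wpM2l; [lra|rewrite ler_peMl].
  by lra.
move=> U w mU cX.
have split_sum : \sum_(i < n) (U (X i w))%:R * phi (xi i w) -
    n%:R * mphi * cell_prob (pattern U J) =
    \sum_(j < J.+1) centered_sum (chain_set (pattern U j)) w +
    \sum_(i < n) ((U (X i w))%:R - (dyadic_cell J (X i w) \in pattern U J)%:R) *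
      phi (xi i w).
  rewrite sumrB (cell_prob_telescope J mU) mulr_sumr.
  under [X in _ = _ + X]eq_bigr do rewrite mulrBl.
  rewrite sumrB exchange_big/=.
  under [X in _ = X - _ + _]eq_bigr do rewrite -mulr_suml -(pattern_telescope mU).
  lra.
rewrite split_sum; apply: le_trans (ler_normD _ _) _; apply: lerD.
  apply: le_trans (ler_norm_sum _ _ _) _; apply: ler_sum => j _.
  by apply: (GP j).2; exact: pattern_upset.
apply: le_trans (BP _ w (pattern_upset mU J)).
apply: le_trans (ler_norm_sum _ _ _) _; apply: ler_sum => i _.
rewrite normrM ler_wpM2r//.
have [Pi|Pi] := boolP (dyadic_cell J (X i w) \in pattern U J).
  by rewrite (pattern_sub mU (cX i) Pi) subrr normr0.
rewrite subr0; have [Ui|_] := boolP (U _); last by rewrite normr0.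
have := up_corner_boundary (mU _ _ (cX i) (up_corner_cube _) (up_corner_ge J (cX i)) Ui).
by rewrite (negbTE Pi) /= => ->; rewrite normr1.
Qed.

End process.

(** * From upper sets to monotone functions *)

Lemma expR_le_inv {R : realType} (t : R) : t < 1 -> expR t <= (1 - t)^-1.
Proof.
move=> t1; rewrite -[X in expR X]opprK expRN lef_pV2 ?posrE ?expR_gt0 ?subr_gt0//.
by have := @expR_ge1Dx R (- t); lra.
Qed.

(** Applying [expR_le_inv] at l/2 and squaring keeps the estimate finite up to [l = 1]. *)
Lemma expR_le_quadratic {R : realType} (l : R) : -1 <= l <= 1 ->
  expR l <= 1 + l + 2 * l ^+ 2.
Proof.
move=> /andP[lN1 l1].
have h1 : l / 2 < 1 by lra.
have := expR_le_inv h1; set e := expR (l / 2) => he.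
have -> : expR l = e ^+ 2 by rewrite -expRM_natl; congr expR; field.
have e0 : 0 <= e by exact: expR_ge0.
have {}he : e * (1 - l / 2) <= 1 by rewrite -ler_pdivlMr ?div1r//; lra.
have p0 : 0 < (1 - l / 2) ^+ 2 by rewrite exprn_gt0//; lra.
rewrite -(ler_pM2r p0); apply: (@le_trans _ _ 1).
  by rewrite -exprMn; apply: exprn_ile1 => //; rewrite mulr_ge0//; lra.
have -> : (1 + l + 2 * l ^+ 2) * (1 - l / 2) ^+ 2 =
  1 + l ^+ 2 * ((1 - l) * (5 - 2 * l) / 4) by field.
by rewrite lerDl mulr_ge0 ?sqr_ge0// divr_ge0// mulr_ge0//; lra.
Qed.

Lemma expR_half_sq_le {R : realType} (l : R) : -1 <= l <= 1 ->
  expR (l ^+ 2 / 2) <= 1 + 2 * l ^+ 2.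
Proof.
move=> /andP[lN1 l1]; have l2 : l ^+ 2 <= 1 by nra.
have l20 := sqr_ge0 l.
apply: le_trans (@expR_le_inv R (l ^+ 2 / 2) _) _; first lra.
rewrite -[leLHS]div1r ler_pdivrMr; last lra.
set t := l ^+ 2 in l2 l20 *; nra.
Qed.

Lemma expR1_le4 {R : realType} : expR 1 <= 4 :> R.
Proof. by have := @expR_le_quadratic R 1; rewrite expr1n => H; have := H; lra. Qed.

Lemma normal_abs_exp {R : realType} :
  (\int[normal_prob 0 1]_x (expR `|x : R|)%:E <= 4%:E)%E.
Proof.
have m1 (s : R) : measurable_fun setT (fun x : R => expR (s * x)).
  by apply: measurableT_comp => //; exact: measurable_funM.
apply: (@le_trans _ _ (\int[normal_prob 0 1]_x
    ((expR (1 * x))%:E + (expR (-1 * x))%:E))%E).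
  apply: ge0_le_integral => //.
  - apply/measurable_EFinP; apply: measurableT_comp => //.
  - by apply: emeasurable_funD; apply/measurable_EFinP; exact: m1.
  - move=> x _; rewrite -EFinD lee_fin mul1r mulN1r.
    have [x0|x0] := lerP 0 x.
      by rewrite ger0_norm// lerDl expR_ge0.
    by rewrite ltr0_norm// lerDr expR_ge0.
rewrite ge0_integralD//; last 2 first.
- by apply/measurable_EFinP; exact: m1.
- by apply/measurable_EFinP; exact: m1.
rewrite !normal_mgf -EFinD lee_fin sqrrN expr1n.
have h1 : 1 / 2 < 1 :> R by lra.
have := expR_le_inv h1.
have -> : (1 - 1 / 2)^-1 = 2 :> R by field.
lra.
Qed.

(** * Discrete layer-cake formula *)

Section layer_cake.
Context {R : realType} {d : nat}.
Variables (F : d.-tuple R -> R) (B : R) (K : nat).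
Hypotheses (B0 : 0 < B) (K0 : (0 < K)%N).
Hypothesis F_range : forall x, unit_cube x -> 0 <= F x <= B.
Hypothesis F_mono : monotone_class F.

Definition superlevel (k : nat) (x : d.-tuple R) : bool := B * k.+1%:R / K%:R <= F x.

(** A finite layer-cake sum, which avoids integrating over levels. It is used with [K = n], so that
    the discretization error is of order [B / n]. *)
Definition staircase (x : d.-tuple R) : R :=
  B / K%:R * \sum_(k < K) (superlevel k x)%:R.

Lemma superlevel_mono k x y : unit_cube x -> unit_cube y -> le_coord x y ->
  superlevel k x -> superlevel k y.
Proof. by move=> cx cy xy /le_trans; apply; exact: F_mono. Qed.

Lemma staircase_bounds x : unit_cube x ->
  staircase x <= F x <= staircase x + B / K%:R.
Proof.
move=> cx; have /andP[F0 FB] := F_range cx.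
have KR : 0 < K%:R :> R by rewrite ltr0n.
pose y := K%:R * F x / B.
have y0 : 0 <= y by rewrite divr_ge0 ?mulr_ge0 ?(ltW B0)// ltW.
have yK : y <= K%:R by rewrite ler_pdivrMr// ler_wpM2l// ltW.
have FE : F x = B / K%:R * y by rewrite /y; field; rewrite !gt_eqF.
have /andP[lo hi] := truncn_itv y0.
have supE k : superlevel k x = (k < Num.truncn y)%N.
  rewrite truncn_gt_nat /superlevel FE mulrAC ler_pM2l// divr_gt0//.
have -> : staircase x = B / K%:R * (Num.truncn y)%:R.
  rewrite /staircase -natr_sum; congr (_ * _%:R).
  under eq_bigr do rewrite supE.
  have tK : (Num.truncn y <= K)%N by rewrite -(ler_nat R) (le_trans lo).
  rewrite -(big_mkord xpredT (fun k => nat_of_bool (k < Num.truncn y)%N)).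
  rewrite (big_cat_nat (n := Num.truncn y))//= [X in (_ + X)%N]big1_seq ?addn0.
    rewrite (eq_big_nat _ _ (F2 := fun=> 1%N)); last by move=> i /andP[_ ->].
    by rewrite sum_nat_const_nat muln1 subn0.
  by move=> i /=; rewrite mem_index_iota => /andP[ti _]; rewrite ltnNge ti.
have BK : 0 < B / K%:R by rewrite divr_gt0.
rewrite FE -[X in _ <= _ + X]mulr1 -mulrDr !ler_pM2l// lo/=.
by rewrite -natr1 in hi; rewrite ltW.
Qed.

Lemma layer_cake_linear n (x : 'I_n -> d.-tuple R) (v : 'I_n -> R) (G : R) :
  (forall i, unit_cube (x i)) ->
  (forall U : d.-tuple R -> bool,
    (forall x y, unit_cube x -> unit_cube y -> le_coord x y -> U x -> U y) ->
    `|\sum_(i < n) (U (x i))%:R * v i| <= G) ->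
  `|\sum_(i < n) F (x i) * v i| <= B * G + B / K%:R * \sum_(i < n) `|v i|.
Proof.
move=> cx HG.
have KR : 0 < K%:R :> R by rewrite ltr0n.
have -> : \sum_(i < n) F (x i) * v i = \sum_(i < n) staircase (x i) * v i +
    \sum_(i < n) (F (x i) - staircase (x i)) * v i.
  by rewrite -big_split/=; apply: eq_bigr => i _; ring.
apply: le_trans (ler_normD _ _) _; apply: lerD; last first.
  apply: le_trans (ler_norm_sum _ _ _) _; rewrite mulr_sumr; apply: ler_sum => i _.
  rewrite normrM ler_wpM2r//; have /andP[lo hi] := staircase_bounds (cx i).
  by rewrite ger0_norm; lra.
have -> : \sum_(i < n) staircase (x i) * v i =
    B / K%:R * \sum_(k < K) \sum_(i < n) (superlevel k (x i))%:R * v i.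
  rewrite exchange_big mulr_sumr; apply: eq_bigr => i _.
  by rewrite /staircase -mulrA mulr_suml.
rewrite normrM gtr0_norm ?divr_gt0//.
apply: (@le_trans _ _ (B / K%:R * \sum_(k < K) G)); last first.
  rewrite sumr_const card_ord -[G *+ K]mulr_natl le_eqVlt; apply/orP; left.
  by apply/eqP; field; rewrite gt_eqF.
rewrite ler_pM2l ?divr_gt0//; apply: le_trans (ler_norm_sum _ _ _) _.
by apply: ler_sum => k _; apply: HG => x' y'; exact: superlevel_mono.
Qed.

(** The sums over cells are the upper and lower Darboux sums of [F], standing in for its integral.
    At lower corners a superlevel set is its own pattern; at upper corners it may also occupy cells
    of [upper_boundary], which costs the additional 2d/2^J. *)
Lemma layer_cake_cells n (x : 'I_n -> d.-tuple R) (G : R) J :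
  (0 < n)%N -> (0 < d)%N ->
  (forall i, unit_cube (x i)) ->
  (forall U : d.-tuple R -> bool,
    (forall x y, unit_cube x -> unit_cube y -> le_coord x y -> U x -> U y) ->
    `|\sum_(i < n) (U (x i))%:R - n%:R * cell_prob (pattern U J)| <= G) ->
  \sum_c F (up_corner c) * cell_prob [set c : cell d (2 ^ J)] <=
    n%:R^-1 * \sum_(i < n) F (x i) +
    B * (G / n%:R + 2 * d%:R / (2 ^ J)%:R + K%:R^-1) /\
  n%:R^-1 * \sum_(i < n) F (x i) - B * (G / n%:R + K%:R^-1) <=
    \sum_c F (low_corner c) * cell_prob [set c : cell d (2 ^ J)].
Proof.
move=> n0 d0 cx HG.
have KR : 0 < K%:R :> R by rewrite ltr0n.
have nR : 0 < n%:R :> R by rewrite ltr0n.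
have BK : 0 < B / K%:R by rewrite divr_gt0.
pose avg k : R := n%:R^-1 * \sum_(i < n) (superlevel k (x i))%:R.
pose P k := @cell_prob R d J (pattern (superlevel k) J).
have HP k : avg k - G / n%:R <= P k <= avg k + G / n%:R.
  have := HG _ (@superlevel_mono k); rewrite ler_norml => /andP[h1 h2].
  have e : P k = n%:R^-1 * (n%:R * P k) by rewrite mulrA mulVf ?mul1r// gt_eqF.
  rewrite [G / _]mulrC e /avg -mulrBr -mulrDr !ler_pM2l ?invr_gt0//.
  by apply/andP; split; rewrite /P; lra.
have stair_avg : n%:R^-1 * \sum_(i < n) staircase (x i) = B / K%:R * \sum_(k < K) avg k.
  rewrite /staircase -mulr_sumr exchange_big/= mulrCA; congr (_ * _).
  by rewrite mulr_sumr.
have sumK (z : R) : B / K%:R * \sum_(k < K) z = B * z.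
  by rewrite sumr_const card_ord -[z *+ K]mulr_natl; field; rewrite gt_eqF.
have p0 c : 0 <= @cell_prob R d J [set c] := cell_prob_ge0 _.
have p1 : \sum_c @cell_prob R d J [set c] = 1.
  by rewrite -(@cell_prob_setT R d J) cell_prob_sum; apply: eq_bigl => c; rewrite finset.inE.
have sum_pattern (Q : pred (cell d (2 ^ J))) :
    \sum_c (Q c)%:R * @cell_prob R d J [set c] = cell_prob [set c | Q c]%SET.
  rewrite [RHS]cell_prob_sum [RHS]big_mkcond; apply: eq_bigr => c _.
  by rewrite finset.inE; case: (Q c); rewrite ?mul1r ?mul0r.
have stair_cells (corner : cell d (2 ^ J) -> d.-tuple R) :
    \sum_c staircase (corner c) * cell_prob [set c] =
    B / K%:R * \sum_(k < K) cell_prob [set c | superlevel k (corner c)]%SET.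
  under eq_bigr do rewrite /staircase -mulrA mulr_suml.
  rewrite -mulr_sumr exchange_big/=; congr (_ * _); apply: eq_bigr => k _.
  exact: sum_pattern.
split.
  apply: (@le_trans _ _ (\sum_c (staircase (up_corner c) + B / K%:R) *
      cell_prob [set c : cell d (2 ^ J)])).
    apply: ler_sum => c _; rewrite ler_wpM2r//.
    by have /andP[] := staircase_bounds (@up_corner_cube R d J c).
  under eq_bigr do rewrite mulrDl.
  rewrite big_split/= -[X in _ + X <= _]mulr_sumr p1 mulr1 stair_cells.
  apply: (@le_trans _ _ (B / K%:R * \sum_(k < K)
      (avg k + (G / n%:R + 2 * d%:R / (2 ^ J)%:R)) + B / K%:R)).
    rewrite lerD2r ler_pM2l//; apply: ler_sum => k _.
    set Q := [set c | _]%SET.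
    have sub : Q \subset pattern (superlevel k) J :|: upper_boundary (pattern (superlevel k) J).
      apply/fintype.subsetP => c; rewrite finset.inE finset.in_setU.
      exact: (up_corner_boundary (U := superlevel k)).
    apply: le_trans (cell_probS sub) _.
    apply: le_trans (cell_probU_le _ _) _.
    have := cell_prob_boundary_le (R := R) d0
      (card_upper_boundary (pattern_upset (@superlevel_mono k) J)).
    by have /andP[_] := HP k; rewrite /P; lra.
  rewrite big_split/= mulrDr sumK -stair_avg.
  have : n%:R^-1 * \sum_(i < n) staircase (x i) <= n%:R^-1 * \sum_(i < n) F (x i).
    rewrite ler_pM2l ?invr_gt0//; apply: ler_sum => i _.
    by have /andP[] := staircase_bounds (cx i).
  lra.
apply: (@le_trans _ _
    (\sum_c staircase (low_corner c) * cell_prob [set c : cell d (2 ^ J)])); last first.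
  apply: ler_sum => c _; rewrite ler_wpM2r//.
  by have /andP[] := staircase_bounds (@low_corner_cube R d J c).
rewrite stair_cells.
apply: (@le_trans _ _ (B / K%:R * \sum_(k < K) (avg k + - (G / n%:R)))); last first.
  rewrite ler_pM2l//; apply: ler_sum => k _.
  by have /andP[] := HP k.
rewrite big_split/= [in leRHS]mulrDr sumK -stair_avg.
have : n%:R^-1 * \sum_(i < n) F (x i) <= n%:R^-1 * \sum_(i < n) (staircase (x i) + B / K%:R).
  rewrite ler_pM2l ?invr_gt0//; apply: ler_sum => i _.
  by have /andP[] := staircase_bounds (cx i).
rewrite big_split/= sumr_const card_ord.
have -> : n%:R^-1 * (\sum_(i < n) staircase (x i) + (B / K%:R) *+ n) =
  n%:R^-1 * \sum_(i < n) staircase (x i) + B / K%:R.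
  by rewrite -[_ *+ n]mulr_natl; field; rewrite !gt_eqF.
lra.
Qed.

End layer_cake.

(** The integral of a nonnegative function is a supremum over simple functions below it, so it is
    monotone without any measurability. The squared loss of an arbitrary estimator requires this. *)
Lemma ge0_le_integral_nonmeasurable {disp : measure_display}
    {T : measurableType disp} {R : realType} (mu : {measure set T -> \bar R})
    (D : set T) (f g : T -> \bar R) :
  (forall x, D x -> 0 <= f x)%E -> (forall x, D x -> f x <= g x)%E ->
  (\int[mu]_(x in D) f x <= \int[mu]_(x in D) g x)%E.
Proof.
move=> f0 fg; have g0 x : D x -> (0 <= g x)%E.
  by move=> Dx; exact: le_trans (f0 x Dx) (fg x Dx).
rewrite !ge0_integralE//; apply: le_ereal_sup => _ [h hf <-]; exists h => // x.
apply: le_trans (hf x) _; rewrite !patchE; case: ifPn => // /set_mem; exact: fg.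
Qed.

(** * Loss in terms of the two processes, at a fixed sample point *)

Section deterministic_loss.
Context {R : realType} {d : nat}.

Lemma sq_L2_norm_le_cells J (g : d.-tuple R -> R) (H : cell d (2 ^ J) -> R) :
  (forall c, 0 <= H c) ->
  (forall x, unit_cube x -> g x ^+ 2 <= H (dyadic_cell J x)) ->
  (sq_L2_norm g <= (\sum_c H c * cell_prob [set c])%:E)%E.
Proof.
move=> H0 gH.
apply: (@le_trans _ _ (\int[uniform_cube d]_(x in unit_cube) (H (dyadic_cell J x))%:E)%E).
  apply: ge0_le_integral_nonmeasurable => x cx; rewrite lee_fin ?sqr_ge0//.
  exact: gH.
have HE x : H (dyadic_cell J x) = \sum_c H c * (dyadic_cell J x \in [set c]%SET)%:R.
  rewrite (bigD1 (dyadic_cell J x))//= finset.inE eqxx mulr1 big1 ?addr0// => c cx.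
  by rewrite finset.inE eq_sym (negbTE cx) mulr0.
have mH : measurable_fun setT (fun x : d.-tuple R => H (dyadic_cell J x)).
  under eq_fun do rewrite HE.
  apply: measurable_sum => c; apply: measurable_funM => //.
  exact: measurable_mem_cells.
apply: (@le_trans _ _ (\int[uniform_cube d]_x (H (dyadic_cell J x))%:E)%E).
  apply: ge0_subset_integral => //; first exact: measurable_unit_cube.
  - exact/measurable_EFinP.
  - by move=> x _; rewrite lee_fin.
under eq_integral do rewrite HE -sumEFin.
rewrite ge0_integral_sum//; last 2 first.
- move=> c; apply/measurable_EFinP/measurable_funM => //.
  exact: measurable_mem_cells.
- by move=> c x _; rewrite lee_fin mulr_ge0.
rewrite -sumEFin; apply: lee_sum => c _.
under eq_integral do rewrite EFinM.
rewrite ge0_integralZl_EFin//.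
- by rewrite cell_probE.
- by apply/measurable_EFinP; exact: measurable_mem_cells.
Qed.

Lemma monotone_class_mul (f g : d.-tuple R -> R) :
  monotone_class f -> monotone_class g ->
  (forall x, unit_cube x -> 0 <= f x) -> (forall x, unit_cube x -> 0 <= g x) ->
  monotone_class (fun x => f x * g x).
Proof.
by move=> mf mg f0 g0 x y cx cy xy; apply: ler_pM; [exact: f0|exact: g0|exact: mf|exact: mg].
Qed.

Lemma loss_bound n J (x : 'I_n -> d.-tuple R) (v : 'I_n -> R)
    (f f0 : d.-tuple R -> R) (M G1 Gv : R) :
  (0 < n)%N -> (0 < d)%N -> 0 < M ->
  (forall i, unit_cube (x i)) -> (forall i, `|v i| <= M) ->
  monotone_class f -> monotone_class f0 ->
  (forall z, unit_cube z -> `|f z| <= M) -> (forall z, unit_cube z -> `|f0 z| <= M) ->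
  \sum_(i < n) (f0 (x i) + v i - f (x i)) ^+ 2 <= \sum_(i < n) v i ^+ 2 ->
  (forall U : d.-tuple R -> bool,
    (forall x y, unit_cube x -> unit_cube y -> le_coord x y -> U x -> U y) ->
    `|\sum_(i < n) (U (x i))%:R - n%:R * cell_prob (pattern U J)| <= G1) ->
  (forall U : d.-tuple R -> bool,
    (forall x y, unit_cube x -> unit_cube y -> le_coord x y -> U x -> U y) ->
    `|\sum_(i < n) (U (x i))%:R * v i| <= Gv) ->
  (sq_L2_norm (fun z => (f z - f0 z)%R) <=
   (8 * M / n%:R * Gv + 16 * M ^+ 2 / n%:R * G1 +
    (24 / n%:R + 16 * d%:R / (2 ^ J)%:R) * M ^+ 2)%:E)%E.
Proof.
move=> n0 d0 M0 cx vM mf mf0 fM f0M lse HG1 HGv.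
have nR : 0 < n%:R :> R by rewrite ltr0n.
pose h z := f z + M; pose h0 z := f0 z + M.
have hr z : unit_cube z -> 0 <= h z <= 2 * M.
  by move=> /fM; rewrite ler_norml /h => /andP[? ?]; apply/andP; split; lra.
have h0r z : unit_cube z -> 0 <= h0 z <= 2 * M.
  by move=> /f0M; rewrite ler_norml /h0 => /andP[? ?]; apply/andP; split; lra.
have hp z : unit_cube z -> 0 <= h z by move=> /hr /andP[].
have h0p z : unit_cube z -> 0 <= h0 z by move=> /h0r /andP[].
have mh : monotone_class h by move=> y z cy cz yz; rewrite lerD2r; exact: mf.
have mh0 : monotone_class h0 by move=> y z cy cz yz; rewrite lerD2r; exact: mf0.
pose B := 4 * M ^+ 2.
have B0 : 0 < B by rewrite mulr_gt0// exprn_gt0.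
have M20 : 0 < 2 * M by rewrite mulr_gt0.
have prod_range (u v' : d.-tuple R -> R) :
    (forall z, unit_cube z -> 0 <= u z <= 2 * M) ->
    (forall z, unit_cube z -> 0 <= v' z <= 2 * M) ->
    forall z, unit_cube z -> 0 <= u z * v' z <= B.
  move=> ur vr z cz; have /andP[u0 uM] := ur z cz; have /andP[v0 vM'] := vr z cz.
  rewrite mulr_ge0//=; have -> : B = (2 * M) * (2 * M) by rewrite /B; ring.
  exact: ler_pM.
have cells (u v' : d.-tuple R -> R) ur vr mu mv := @layer_cake_cells R d
  (fun z => u z * v' z) B n B0 n0 (prod_range u v' ur vr)
  (monotone_class_mul mu mv (fun z cz => (andP (ur z cz)).1)
    (fun z cz => (andP (vr z cz)).1)) n x G1 J n0 d0 cx HG1.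
have [up1 _] := cells h h hr hr mh mh.
have [_ lo2] := cells h h0 hr h0r mh mh0.
have [up3 _] := cells h0 h0 h0r h0r mh0 mh0.
(* A majorant of (f - f0)^2 that is constant on cells: the squares are taken at the upper corner,
   and the product, which has a minus sign, at the lower one. *)
pose H (c : cell d (2 ^ J)) := h (up_corner c) * h (up_corner c) -
  2 * (h (low_corner c) * h0 (low_corner c)) + h0 (up_corner c) * h0 (up_corner c).
have low_up (c : cell d (2 ^ J)) : le_coord (low_corner c) (up_corner c : d.-tuple R).
  move=> k; rewrite !tnth_mktuple ler_pM2r ?invr_gt0 ?ltr0n ?expn_gt0//.
  by rewrite ler_nat.
have H0 c : 0 <= H c.
  have a1 := mh _ _ (low_corner_cube c) (up_corner_cube c) (low_up c).
  have b1 := mh0 _ _ (low_corner_cube c) (up_corner_cube c) (low_up c).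
  have a0 := hp _ (low_corner_cube c); have b0 := h0p _ (low_corner_cube c).
  have := ler_pM a0 b0 a1 b1; have := sqr_ge0 (h (up_corner c) - h0 (up_corner c)).
  by rewrite /H; nra.
have fH z : unit_cube z -> (f z - f0 z) ^+ 2 <= H (dyadic_cell J z).
  move=> cz; have cl := low_corner_cube (R := R) (dyadic_cell J z).
  have cu := up_corner_cube (R := R) (dyadic_cell J z).
  have lz := low_corner_le J cz; have zu := up_corner_ge J cz.
  have e : (f z - f0 z) ^+ 2 = h z * h z - 2 * (h z * h0 z) + h0 z * h0 z.
    by rewrite /h /h0; ring.
  have := ler_pM (hp _ cz) (hp _ cz) (mh _ _ cz cu zu) (mh _ _ cz cu zu).
  have := ler_pM (h0p _ cz) (h0p _ cz) (mh0 _ _ cz cu zu) (mh0 _ _ cz cu zu).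
  have := ler_pM (hp _ cl) (h0p _ cl) (mh _ _ cl cz lz) (mh0 _ _ cl cz lz).
  by rewrite e /H; lra.
apply: le_trans (sq_L2_norm_le_cells H0 fH) _; rewrite lee_fin.
have -> : \sum_c H c * cell_prob [set c] =
    \sum_c h (up_corner c) * h (up_corner c) * @cell_prob R d J [set c] -
    2 * (\sum_c h (low_corner c) * h0 (low_corner c) * @cell_prob R d J [set c]) +
    \sum_c h0 (up_corner c) * h0 (up_corner c) * @cell_prob R d J [set c].
  rewrite mulr_sumr -sumrB -big_split/=; apply: eq_bigr => c _; rewrite /H; ring.
have avgE : n%:R^-1 * (\sum_(i < n) h (x i) * h (x i)) -
    2 * (n%:R^-1 * (\sum_(i < n) h (x i) * h0 (x i))) +
    n%:R^-1 * (\sum_(i < n) h0 (x i) * h0 (x i)) =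
    n%:R^-1 * \sum_(i < n) (f (x i) - f0 (x i)) ^+ 2.
  rewrite mulrCA -mulrBr -mulrDr; congr (_ * _).
  rewrite mulr_sumr -sumrB -big_split/=; apply: eq_bigr => i _; rewrite /h /h0; ring.
(* Expanding the least squares comparison; the shifts by [M] cancel in [h - h0]. *)
have basic : \sum_(i < n) (f (x i) - f0 (x i)) ^+ 2 <=
    2 * (\sum_(i < n) h (x i) * v i - \sum_(i < n) h0 (x i) * v i).
  rewrite -sumrB mulr_sumr -(lerD2r (\sum_(i < n) v i ^+ 2)).
  rewrite [leRHS]addrC; rewrite -lerBlDr; apply: le_trans _ lse.
  rewrite -big_split -sumrB /= le_eqVlt; apply/orP; left; apply/eqP.
  by apply: eq_bigr => i _; rewrite /h /h0; ring.
have sv : \sum_(i < n) `|v i| <= n%:R * M.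
  by rewrite mulr_natl -[X in _ *+ X]card_ord -sumr_const; apply: ler_sum => i _.
have lin := layer_cake_linear M20 n0 hr mh cx HGv.
have lin0 := layer_cake_linear M20 n0 h0r mh0 cx HGv.
have bnd : 2 * M / n%:R * \sum_(i < n) `|v i| <= 2 * M ^+ 2.
  have -> : 2 * M ^+ 2 = 2 * M / n%:R * (n%:R * M) by field; rewrite gt_eqF.
  by rewrite ler_wpM2l// divr_ge0// ltW.
move: lin lin0; rewrite !ler_norml => /andP[_ lin] /andP[lin0 _].
have key : n%:R^-1 * \sum_(i < n) (f (x i) - f0 (x i)) ^+ 2 <=
    n%:R^-1 * (8 * M * Gv + 8 * M ^+ 2).
  by rewrite ler_pM2l ?invr_gt0//; lra.
have -> : 8 * M / n%:R * Gv + 16 * M ^+ 2 / n%:R * G1 +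
    (24 / n%:R + 16 * d%:R / (2 ^ J)%:R) * M ^+ 2 =
  n%:R^-1 * (8 * M * Gv + 8 * M ^+ 2) +
  2 * (B * (G1 / n%:R + 2 * d%:R / (2 ^ J)%:R + n%:R^-1)) +
  2 * (B * (G1 / n%:R + n%:R^-1)).
  by rewrite /B; field; rewrite !gt_eqF// ltr0n expn_gt0.
lra.
Qed.

End deterministic_loss.

(** * Rates and risk *)

Section rate.
Context {R : realType} {d n : nat}.
Hypotheses (d2 : (1 < d)%N) (n0 : (0 < n)%N).
(** The finest dyadic grid with at most [n] cells. *)
Let J := trunc_log (2 ^ d) n.
Let L : R := ln (Num.max (expR 1) n%:R).

Lemma level_le : (2 ^ (J * d) <= n)%N.
Proof.
have p1 : (1 < 2 ^ d)%N by rewrite -[X in (X < _)%N](expn0 2) ltn_exp2l// ltnW.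
by have /andP[+ _] := trunc_log_bounds p1 n0; rewrite -expnM mulnC.
Qed.

Lemma mesh_ge : n%:R^-1 <= (2 ^ J)%:R^-1 :> R.
Proof.
rewrite lef_pV2 ?posrE ?ltr0n ?expn_gt0// ler_nat; apply: leq_trans level_le.
by rewrite leq_exp2l// leq_pmulr// ltnW.
Qed.

(** Maximality of [J] gives n < 2^(d (J+1)); taking d-th roots, the extra level becomes the factor
    2. *)
Lemma mesh_le : (2 ^ J)%:R^-1 <= 2 * n%:R `^ (- d%:R^-1) :> R.
Proof.
have p1 : (1 < 2 ^ d)%N by rewrite -[X in (X < _)%N](expn0 2) ltn_exp2l// ltnW.
have /andP[_ /ltnW hi] := trunc_log_bounds p1 n0.
have m0 : 0 < (2 ^ J)%:R :> R by rewrite ltr0n expn_gt0.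
have x0 : 0 < n%:R `^ d%:R^-1 :> R by rewrite powR_gt0// ltr0n.
rewrite powRN -[leLHS]div1r ler_pdivrMr// mulrAC ler_pdivlMr// mul1r -natrM -expnS.
have -> : (2 ^ J.+1)%:R = ((2 ^ d) ^ J.+1)%:R `^ d%:R^-1 :> R.
  have -> : ((2 ^ d) ^ J.+1)%:R = (2 ^ J.+1)%:R `^ d%:R :> R.
    by rewrite powR_mulrn// -natrX -!expnM mulnC.
  rewrite -powRrM mulfV ?powRr1//.
  by rewrite pnatr_eq0 -lt0n ltnW.
by apply: ge0_ler_powR; rewrite ?nnegrE// ler_nat.
Qed.

Lemma log_ge1 : 1 <= L.
Proof.
by rewrite -[leLHS](expRK (1 : R)) ler_ln ?posrE ?lt_max ?expR_gt0// le_max lexx.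
Qed.

Lemma le_expR_log : n%:R <= expR L.
Proof. by rewrite lnK ?posrE ?lt_max ?expR_gt0// le_max lexx orbT. Qed.

Lemma level_le_log : J%:R <= 2 * L.
Proof.
have e2 : expR (1 / 2) <= 2 :> R.
  have h1 : 1 / 2 < 1 :> R by lra.
  by have := expR_le_inv h1; have -> : (1 - 1 / 2)^-1 = 2 :> R by field.
have : expR (J%:R * (1 / 2)) <= expR L :> R.
  apply: le_trans le_expR_log; rewrite expRM_natl.
  apply: (@le_trans _ _ (2 ^+ J)).
    by apply: lerXn2r; rewrite ?nnegrE ?expR_ge0.
  rewrite -natrX ler_nat; apply: leq_trans level_le.
  by rewrite leq_exp2l// leq_pmulr// ltnW.
by rewrite ler_expR; lra.
Qed.

(** The factor [L] on the left comes from truncating the noise and is present in every dimension;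
    for d = 2 the number of levels supplies the second logarithm. *)
Lemma level_factor_le :
  (if d == 2 then J.+1%:R else 4) * L <= 4 * L ^+ gamma_iso d.
Proof.
have L1 := log_ge1; have JL := level_le_log.
rewrite /gamma_iso; case: ifP => _; last by rewrite expr1.
by rewrite -natr1 expr2 mulrA ler_wpM2r//; lra.
Qed.

End rate.

(** * Majorants of the two processes and of the outer expectation *)

Section isotonic_risk.
Context {R : realType} {d n : nat} {disp : measure_display}
  {T : measurableType disp}.
Variable Pr : probability T R.
Variables (X : 'I_n -> {RV Pr >-> d.-tuple R}) (xi : 'I_n -> {RV Pr >-> R}).
Hypothesis model : gaussian_random_design X xi.
Hypotheses (d2 : (1 < d)%N) (n0 : (0 < n)%N).
Variable J : nat.
Hypothesis Jn : (2 ^ (J * d) <= n)%N.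

Lemma empirical_process_bound : exists G : T -> R,
  mean_le Pr G ((7 + 10 * d%:R) * (if d == 2 then J.+1%:R else 4) *
    (n%:R / (2 ^ J)%:R)) /\
  forall (U : d.-tuple R -> bool) w,
    (forall x y, unit_cube x -> unit_cube y -> le_coord x y -> U x -> U y) ->
    (forall i, unit_cube (X i w)) ->
    `|\sum_(i < n) (U (X i w))%:R - n%:R * cell_prob (pattern U J)| <= G w.
Proof.
have mgf (l : R) : -1 <= l <= 1 ->
    (\int[normal_prob 0 1]_x (expR (l * cst 1 (x : R)))%:E <= (1 + l * 1 + 2 * l ^+ 2)%:E)%E.
  move=> l1; rewrite /= integral_cst//= probability_setT mule1 lee_fin !mulr1.
  exact: expR_le_quadratic.
have abs : (\int[normal_prob 0 1]_x (expR `|cst 1 (x : R)| : R)%:E <= 4%:E)%E.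
  by rewrite /= integral_cst//= probability_setT mule1 lee_fin normr1 expR1_le4.
have [G [mG GP]] := process_bound model d2 n0 (measurable_cst (1 : R)) mgf abs Jn.
exists G; split => // U w mU cX; have := GP U w mU cX.
by rewrite mulr1; under eq_bigr do rewrite /= mulr1.
Qed.

Lemma multiplier_process_bound : exists G : T -> R,
  mean_le Pr G ((7 + 10 * d%:R) * (if d == 2 then J.+1%:R else 4) *
    (n%:R / (2 ^ J)%:R)) /\
  forall (U : d.-tuple R -> bool) w,
    (forall x y, unit_cube x -> unit_cube y -> le_coord x y -> U x -> U y) ->
    (forall i, unit_cube (X i w)) ->
    `|\sum_(i < n) (U (X i w))%:R * xi i w| <= G w.
Proof.
have mgf (l : R) : -1 <= l <= 1 ->
    (\int[normal_prob 0 1]_x (expR (l * id (x : R)))%:E <= (1 + l * 0 + 2 * l ^+ 2)%:E)%E.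
  by move=> l1; rewrite normal_mgf lee_fin mulr0 addr0 expR_half_sq_le.
have [G [mG GP]] := process_bound model d2 n0 (@measurable_id _ _ setT) mgf normal_abs_exp Jn.
exists G; split => // U w mU cX; have := GP U w mU cX.
by rewrite mulr0 mul0r subr0.
Qed.

Lemma error_exp_sq (i : 'I_n) : mean_le Pr (fun w => expR (xi i w ^+ 2 / 4)) 2.
Proof.
have mf : measurable_fun setT (fun x : R => expR (x ^+ 2 / 4)).
  by apply: measurableT_comp => //; apply: measurable_funM.
split.
- exact: (measurableT_comp mf).
- by move=> w; exact: expR_ge0.
apply: le_trans (@normal_exp_sq_moment R).
have mxi : measurable_fun setT (xi i) by [].
have law A : measurable A ->
    (\int[Pr]_w (\1_A (xi i w) * cst 1 w)%:E = normal_prob 0 1 A * (1 : R)%:E)%E.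
  move=> mA; rewrite mule1 -(error_law model i mA) /distribution /pushforward.
  under eq_integral do rewrite mulr1.
  rewrite (_ : (\int[_]_w _)%E = (\int[Pr]_w (\1_(xi i @^-1` A) w)%:E)%E).
    by rewrite integral_indic ?setIT// -[X in measurable X]setTI; exact: mxi.
  by apply: eq_integral => w _; rewrite !indicE.
have := ge0_integral_weighted (mu := normal_prob 0 1) mxi (measurable_cst (1 : R))
  (fun=> ler01) law mf (fun x => expR_ge0 _).
by rewrite mul1e => <-; under [leRHS]eq_integral do rewrite mulr1.
Qed.

(** The covariates are in the cube only almost surely. Adding to [g] an infinite penalty on the null
    event that some covariate leaves the cube gives a measurable majorant everywhere with the same
    integral. *)
Lemma outer_expectation_le (Z : T -> \bar R) (g : T -> R) (b : R) :
  mean_le Pr g b ->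
  (forall w, (forall i, unit_cube (X i w)) -> (Z w <= (g w)%:E)%E) ->
  (outer_expectation Pr Z <= b%:E)%E.
Proof.
move=> [mg g0 gb] Zg.
pose N i w : \bar R := (+oo * (\1_(~` unit_cube) (X i w))%:E)%E.
have N0 i w : (0 <= N i w)%E by rewrite /N mule_ge0// lee_fin.
have mcube : measurable (~` @unit_cube R d).
  by apply: measurableC; exact: measurable_unit_cube.
have m1 i : measurable_fun setT (fun w => (\1_(~` unit_cube) (X i w) : R)%:E).
  by apply/measurable_EFinP; exact: measurableT_comp.
have mN i : measurable_fun setT (N i) by apply: measurable_funeM.
have mS : measurable_fun setT (fun w => \sum_(i < n) N i w)%E.
  by apply: emeasurable_sum.
apply: (@le_trans _ _ (\int[Pr]_w ((g w)%:E + \sum_(i < n) N i w))%E).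
  apply: ereal_inf_lbound; exists (fun w => (g w)%:E + \sum_(i < n) N i w)%E => //.
  split; first by apply: emeasurable_funD => //; exact/measurable_EFinP.
  move=> w; have [cX|/existsNP[i Ni]] := pselect (forall i, unit_cube (X i w)).
    by apply: le_trans (Zg w cX) _; rewrite leeDl// sume_ge0.
  rewrite (bigD1 i)//= {1}/N indicE mem_set//= mule1.
  rewrite addye ?addey ?leey//.
  by rewrite gt_eqF// (lt_le_trans (ltNyr 0))// sume_ge0.
have mgE : measurable_fun setT (fun w => (g w)%:E) by exact/measurable_EFinP.
have S0 w : setT w -> (0 <= \sum_(i < n) N i w)%E by rewrite sume_ge0.
rewrite ge0_integralD//; last by move=> w _; rewrite lee_fin.
rewrite ge0_integral_sum// big1 ?adde0// => i _.
rewrite /N ge0_integralZl//.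
have -> : (\int[Pr]_w (\1_(~` unit_cube) (X i w))%:E = 0)%E.
  rewrite (_ : (\int[_]_w _)%E = (\int[Pr]_w (\1_(X i @^-1` (~` unit_cube)) w)%:E)%E).
    have mX : measurable_fun setT (X i) by [].
    rewrite integral_indic// ?setIT; last first.
      by rewrite -[X in measurable X]setTI; exact: mX.
    rewrite [LHS](covariate_law model i mcube) probability_setC.
      by rewrite uniform_unit_cube subee.
    exact: measurable_unit_cube.
  by apply: eq_integral => w _; rewrite !indicE.
by rewrite mule0.
Qed.

End isotonic_risk.

(** * Truncation of the noise and the final risk bound *)

Lemma sq_L2_norm_le_const {R : realType} d (g : d.-tuple R -> R) (c : R) :
  0 <= c -> (forall z, unit_cube z -> g z ^+ 2 <= c) -> (sq_L2_norm g <= c%:E)%E.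
Proof.
move=> c0 gc; apply: le_trans (sq_L2_norm_le_cells (J := 0) (H := fun=> c) _ _) _ => //.
rewrite -mulr_sumr (_ : \sum_c _ = 1) ?mulr1// -(@cell_prob_setT R d 0) cell_prob_sum.
by apply: eq_bigl => e; rewrite finset.inE.
Qed.

(** The loss is at most 16 a^2 = 128 (a^2/8), hence at most 128 exp(a^2/8), and a^2 >= 16 L allows
    exp(a^2/8) to be traded for exp(-2L) exp(a^2/4), whose mean is under control when [a] is the
    size of an error. *)
Lemma tail_loss_bound {R : realType} d (f f0 : d.-tuple R -> R) (a L : R) :
  1 <= L -> 4 * Num.sqrt L <= a ->
  (forall z, unit_cube z -> `|f z| <= 1 + a) ->
  (forall z, unit_cube z -> `|f0 z| <= 1) ->
  (sq_L2_norm (fun z => (f z - f0 z)%R) <=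
   (128 * expR (- (2 * L)) * expR (a ^+ 2 / 4))%:E)%E.
Proof.
move=> L1 La fa f01.
have L0 : 0 <= L by lra.
have s0 := sqrtr_ge0 L; have sL := sqr_sqrtr L0.
have s1 : 1 <= Num.sqrt L by rewrite -[leLHS]sqrtr1 ler_wsqrtr.
have aL : 16 * L <= a ^+ 2.
  have -> : 16 * L = (4 * Num.sqrt L) ^+ 2 by rewrite exprMn sL -natrX.
  by rewrite ler_sqr ?nnegrE//; lra.
apply: sq_L2_norm_le_const.
  by rewrite !mulr_ge0 ?expR_ge0.
move=> z cz; have := fa z cz; have := f01 z cz.
rewrite !ler_norml => /andP[h1 h2] /andP[h3 h4].
have h : (f z - f0 z) ^+ 2 <= (4 * a) ^+ 2.
  rewrite -ler_sqrt ?sqr_ge0// !sqrtr_sqr [leRHS]ger0_norm ?ler_norml; last by lra.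
  by apply/andP; split; lra.
apply: le_trans h _.
have e1 : a ^+ 2 / 8 <= expR (a ^+ 2 / 8) by have := @expR_ge1Dx R (a ^+ 2 / 8); lra.
have e2 : expR (a ^+ 2 / 8) <= expR (- (2 * L)) * expR (a ^+ 2 / 4).
  by rewrite -expRD ler_expR; lra.
by rewrite exprMn -mulrA; lra.
Qed.

Section pointwise_loss.
Context {R : realType} {d n : nat}.
Variables (x : n.-tuple (d.-tuple R)) (v y : n.-tuple R) (f f0 : d.-tuple R -> R).
Variables (J : nat) (L G1 Gv : R).
Hypotheses (d0 : (0 < d)%N) (n0 : (0 < n)%N) (L1 : 1 <= L).
Hypothesis cx : forall i, unit_cube (tnth x i).
Hypothesis yE : forall i, tnth y i = f0 (tnth x i) + tnth v i.
Hypothesis f0_mono : monotone_class f0.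
Hypothesis f0_le1 : forall z, unit_cube z -> `|f0 z| <= 1.
Hypothesis f_lse : is_isotonic_lse x y f.
Hypothesis f_range : within_response_range y f.
Hypothesis HG1 : forall U : d.-tuple R -> bool,
  (forall x y, unit_cube x -> unit_cube y -> le_coord x y -> U x -> U y) ->
  `|\sum_(i < n) (U (tnth x i))%:R - n%:R * cell_prob (pattern U J)| <= G1.
Hypothesis HGv : forall U : d.-tuple R -> bool,
  (forall x y, unit_cube x -> unit_cube y -> le_coord x y -> U x -> U y) ->
  `|\sum_(i < n) (U (tnth x i))%:R * tnth v i| <= Gv.

Let range_le b : (forall i, `|tnth v i| <= b) -> forall z, unit_cube z -> `|f z| <= 1 + b.
Proof.
move=> vb z cz; have [i [j /andP[yi yj]]] := f_range cz.
have := f0_le1 (cx i); have := f0_le1 (cx j); have := vb i; have := vb j.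
rewrite !yE in yi yj; rewrite !ler_norml => /andP[? ?] /andP[? ?] /andP[? ?] /andP[? ?].
by apply/andP; split; lra.
Qed.

(** One distinguishes whether the largest error exceeds 4 sqrt L. Since all terms are nonnegative,
    the bounds of the two cases are added, and no event has to be integrated over. *)
Lemma pointwise_loss_bound :
  (sq_L2_norm (fun z => (f z - f0 z)%R) <=
   (40 * L / n%:R * Gv + 400 * L / n%:R * G1 +
     (24 / n%:R + 16 * d%:R / (2 ^ J)%:R) * (25 * L) +
     128 * expR (- (2 * L)) * \sum_(i < n) expR (tnth v i ^+ 2 / 4))%:E)%E.
Proof.
have nR : 0 < n%:R :> R by rewrite ltr0n.
have L0 : 0 <= L := le_trans ler01 L1.
have s0 := sqrtr_ge0 L; have sL := sqr_sqrtr L0.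
have s1 : 1 <= Num.sqrt L by rewrite -[leLHS]sqrtr1 ler_wsqrtr.
(* The empty upper set witnesses the sign. *)
have G10 : 0 <= G1 by apply: le_trans (normr_ge0 _) (HG1 (U := xpred0) _).
have Gv0 : 0 <= Gv by apply: le_trans (normr_ge0 _) (HGv (U := xpred0) _).
pose i0 : 'I_n := Ordinal n0.
have [i _ imax] := @arg_maxP _ _ _ i0 xpredT (fun i => `|tnth v i|) isT.
set E := \sum_(_ < n) expR _.
have E0 : 0 <= E by rewrite sumr_ge0// => k _; exact: expR_ge0.
have tail0 : 0 <= 128 * expR (- (2 * L)) * E by rewrite !mulr_ge0// expR_ge0.
have m10 : 0 <= 40 * L / n%:R * Gv.
  exact: mulr_ge0 (divr_ge0 (mulr_ge0 (ler0n R 40) L0) (ltW nR)) Gv0.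
have m20 : 0 <= 400 * L / n%:R * G1.
  exact: mulr_ge0 (divr_ge0 (mulr_ge0 (ler0n R 400) L0) (ltW nR)) G10.
have c0 : 0 <= 24 / n%:R + 16 * d%:R / (2 ^ J)%:R :> R.
  by rewrite addr_ge0// divr_ge0// mulr_ge0.
have m30 : 0 <= (24 / n%:R + 16 * d%:R / (2 ^ J)%:R) * (25 * L).
  by rewrite mulr_ge0// mulr_ge0.
have [big|small] := leP (4 * Num.sqrt L) `|tnth v i|.
  apply: le_trans (tail_loss_bound L1 big (range_le (fun k => imax k isT)) f0_le1) _.
  rewrite lee_fin; apply: (@le_trans _ _ (128 * expR (- (2 * L)) * E)); last by lra.
  rewrite ler_wpM2l ?mulr_ge0 ?expR_ge0//.
  by rewrite /E (bigD1 i)//= real_normK ?num_real// lerDl sumr_ge0.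
(* Bounds [f], by the range requirement, as well as [f0] and the errors; it is at most 5 sqrt L
   because L >= 1. *)
set M := 1 + 4 * Num.sqrt L.
have M1 : 1 <= M by rewrite /M; lra.
have M0 : 0 < M by lra.
have M5 : M ^+ 2 <= 25 * L.
  by rewrite /M; set s := Num.sqrt L in sL s1 *; rewrite -sL; nra.
have MM : M <= 5 * L.
  by rewrite /M; set s := Num.sqrt L in sL s1 *; rewrite -sL; nra.
have vs k : `|tnth v k| <= 4 * Num.sqrt L by apply: le_trans (imax k isT) (ltW small).
have vM k : `|tnth v k| <= M by have := vs k; rewrite /M; lra.
have [fm fmin] := f_lse.
have lse : \sum_(i < n) (f0 (tnth x i) + tnth v i - f (tnth x i)) ^+ 2 <=
    \sum_(i < n) tnth v i ^+ 2.
  have := fmin _ f0_mono; rewrite /residual_sum.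
  under eq_bigr do rewrite yE.
  under [leRHS]eq_bigr do rewrite yE addrC addKr.
  by [].
have f0M z : unit_cube z -> `|f0 z| <= M by move=> /f0_le1; lra.
apply: le_trans (loss_bound n0 d0 M0 cx vM fm f0_mono (range_le vs) f0M lse HG1 HGv) _.
rewrite lee_fin.
have t1 : 8 * M / n%:R * Gv <= 40 * L / n%:R * Gv.
  by rewrite ler_wpM2r// ler_pM2r ?invr_gt0//; lra.
have t2 : 16 * M ^+ 2 / n%:R * G1 <= 400 * L / n%:R * G1.
  by rewrite ler_wpM2r// ler_pM2r ?invr_gt0//; lra.
have t3 := ler_wpM2l c0 M5.
lra.
Qed.

End pointwise_loss.

Section risk.
Context {R : realType} {d n : nat} {disp : measure_display}
  {T : measurableType disp}.
Variable Pr : probability T R.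
Variables (X : 'I_n -> {RV Pr >-> d.-tuple R}) (xi : 'I_n -> {RV Pr >-> R}).
Hypothesis model : gaussian_random_design X xi.
Hypotheses (d2 : (1 < d)%N) (n0 : (0 < n)%N).
Variable fhat : n.-tuple (d.-tuple R) -> n.-tuple R -> d.-tuple R -> R.
Hypothesis hlse : forall x y, (forall i, unit_cube (tnth x i)) ->
  is_isotonic_lse x y (fhat x y).
Hypothesis hrange : forall x y, (forall i, unit_cube (tnth x i)) ->
  within_response_range y (fhat x y).

Let L : R := ln (Num.max (expR 1) n%:R).
(** The summands come from the two processes (440 = 40 + 400), from the discretization and boundary
    terms times M^2 <= 25 L, and from the tail of the noise (256 = 128 * 2). *)
Let c : R := 440 * (7 + 10 * d%:R) + 25 * (24 + 16 * d%:R) + 256.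

Lemma isotonic_risk_le (f0 : d.-tuple R -> R) :
  monotone_class f0 -> Linfty_ball 1 f0 ->
  (outer_expectation Pr (fun w =>
     sq_L2_norm (fun z =>
       (fhat (covariates X w) (responses X xi f0 w) z - f0 z)%R)) <=
   (8 * c * n%:R `^ (- d%:R^-1) * L ^+ gamma_iso d)%:E)%E.
Proof.
move=> f0m f0b.
have f01 z : unit_cube z -> `|f0 z| <= 1.
  by move=> cz; rewrite -lee_fin; apply: le_trans f0b; apply: ereal_sup_ubound; exists z.
pose J := trunc_log (2 ^ d) n; have Jn : (2 ^ (J * d) <= n)%N := level_le d2 n0.
have [G1 [mG1 HG1]] := empirical_process_bound model d2 n0 Jn.
have [Gv [mGv HGv]] := multiplier_process_bound model d2 n0 Jn.
set q : R := (2 ^ J)%:R^-1; have q0 : 0 < q by rewrite invr_gt0 ltr0n expn_gt0.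
set k : R := if d == 2 then J.+1%:R else 4 in mG1 mGv.
have k1 : 1 <= k by rewrite /k; case: ifP => _; rewrite ?ler1n.
have nR : 0 < n%:R :> R by rewrite ltr0n.
have L1 : 1 <= L := @log_ge1 R n.
have L0 : 0 <= L by lra.
have nq : n%:R^-1 <= q := mesh_ge d2 n0.
have [sq0 sq1] : 0 <= 40 * L / n%:R /\ 0 <= 400 * L / n%:R.
  split; first exact: divr_ge0 (mulr_ge0 (ler0n R 40) L0) (ltW nR).
  exact: divr_ge0 (mulr_ge0 (ler0n R 400) L0) (ltW nR).
have c0 : 0 <= (24 / n%:R + 16 * d%:R * q) * (25 * L).
  by rewrite !mulr_ge0 ?addr_ge0 ?divr_ge0 ?mulr_ge0// ltW.
have mg := mean_leD (mean_leD (mean_leD (mean_leZ sq0 mGv) (mean_leZ sq1 mG1))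
    (mean_le_cst Pr c0))
  (mean_leZ (mulr_ge0 (ler0n R 128) (expR_ge0 (- (2 * L))))
    (mean_le_sum (index_enum 'I_n) (P := xpredT) (fun i _ => error_exp_sq model i))).
apply: (outer_expectation_le model (mean_leW _ mg)); last first.
  move=> w cX.
  have cX' i : unit_cube (tnth (covariates X w) i) by rewrite tnth_mktuple.
  have := @pointwise_loss_bound R d n (covariates X w) (errors xi w)
    (responses X xi f0 w) _ f0 J L (G1 w) (Gv w) (ltnW d2) n0 L1 cX' _ f0m f01
    (hlse _ cX') (hrange _ cX').
  have -> : \sum_(i < n) expR (xi i w ^+ 2 / 4) =
      \sum_(i < n) expR (tnth (errors xi w) i ^+ 2 / 4).
    by apply: eq_bigr => i _; rewrite tnth_mktuple.
  apply.
  - by move=> i; rewrite !tnth_mktuple.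
  - by move=> U mU; under eq_bigr do rewrite tnth_mktuple; exact: HG1.
  - by move=> U mU; under eq_bigr do rewrite !tnth_mktuple; exact: HGv.
rewrite sumr_const card_ord.
set A := (7 + 10 * d%:R) * k * (n%:R / (2 ^ J)%:R).
have e1 : 40 * L / n%:R * A = 40 * (7 + 10 * d%:R) * (k * L * q).
  by rewrite /A /q; field; rewrite !gt_eqF// ltr0n expn_gt0.
have e2 : 400 * L / n%:R * A = 400 * (7 + 10 * d%:R) * (k * L * q).
  by rewrite /A /q; field; rewrite !gt_eqF// ltr0n expn_gt0.
have Lq0 : 0 <= L * q by rewrite mulr_ge0// ltW.
have kLq : L * q <= k * L * q by rewrite -mulrA ler_peMl.
have qkLq : q <= k * L * q by apply: le_trans kLq; rewrite ler_peMl// ltW.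
have e3 : (24 / n%:R + 16 * d%:R * q) * (25 * L) <= 25 * (24 + 16 * d%:R) * (k * L * q).
  apply: (@le_trans _ _ (25 * (24 + 16 * d%:R) * (L * q))).
    have -> : 25 * (24 + 16 * d%:R) * (L * q) = (24 * q + 16 * d%:R * q) * (25 * L) by ring.
    by rewrite ler_wpM2r ?mulr_ge0// lerD2r; lra.
  by rewrite ler_wpM2l// mulr_ge0// addr_ge0// mulr_ge0.
(* The tail contributes at most 256/n because n <= exp L, and 1/n is at most the mesh. *)
have e4 : 128 * expR (- (2 * L)) * (2 *+ n) <= 256 * (k * L * q).
  have nL : n%:R <= expR L := @le_expR_log R n.
  have : expR (- (2 * L)) * (n%:R * n%:R) <= 1.
    rewrite expRN mulrC ler_pdivrMr ?expR_gt0// mul1r.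
    have -> : expR (2 * L) = expR L * expR L by rewrite -expRD; congr expR; ring.
    by apply: ler_pM.
  rewrite mulrA -ler_pdivlMr// div1r => h.
  have : expR (- (2 * L)) * n%:R <= q by exact: le_trans h nq.
  rewrite -[2 *+ n]mulr_natr; lra.
(* The factor 8 is 4 from [level_factor_le] times 2 from [mesh_le]. *)
have final : c * (k * L * q) <= 8 * c * n%:R `^ (- d%:R^-1) * L ^+ gamma_iso d.
  have kL : k * L <= 4 * L ^+ gamma_iso d := level_factor_le d2 n0.
  have cc : 0 <= c by rewrite /c !addr_ge0// mulr_ge0// addr_ge0// mulr_ge0.
  have qn : q <= 2 * n%:R `^ (- d%:R^-1) := mesh_le d2 n0.
  have -> : 8 * c * n%:R `^ (- d%:R^-1) * L ^+ gamma_iso d =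
    c * (4 * L ^+ gamma_iso d * (2 * n%:R `^ (- d%:R^-1))) by ring.
  rewrite ler_wpM2l//; apply: ler_pM => //; last exact: ltW.
  by rewrite mulr_ge0//; lra.
apply: le_trans final; rewrite e1 e2 /c; lra.
Qed.

End risk.

Theorem theorem3p6 (R : realType) (d : nat) (hd : (2 <= d)%N) :
  exists C : R, 0 < C /\
  forall (n : nat) (hn : (0 < n)%N)
    (disp : measure_display) (T : measurableType disp) (Pr : probability T R)
    (X : 'I_n -> {RV Pr >-> d.-tuple R}) (xi : 'I_n -> {RV Pr >-> R})
    (hmodel : gaussian_random_design X xi)
    (fhat : n.-tuple (d.-tuple R) -> n.-tuple R -> d.-tuple R -> R)
    (hlse : forall x y, (forall i, unit_cube (tnth x i)) ->
      is_isotonic_lse x y (fhat x y))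
    (hrange : forall x y, (forall i, unit_cube (tnth x i)) ->
      within_response_range y (fhat x y)),
  (ereal_sup
     [set outer_expectation Pr (fun w =>
        sq_L2_norm (fun z =>
          (fhat (covariates X w) (responses X xi f0 w) z - f0 z)%R))
     | f0 in @monotone_class R d `&` @Linfty_ball R d 1]
   <= (C * n%:R `^ (- d%:R^-1)
         * ln (Num.max (expR 1) n%:R) ^+ gamma_iso d)%:E)%E.
Proof.
exists (8 * (440 * (7 + 10 * d%:R) + 25 * (24 + 16 * d%:R) + 256)); split.
  by have := ler0n R d; lra.
move=> n hn disp T Pr X xi hmodel fhat hlse hrange.
apply: ge_ereal_sup => _ [f0 [f0m f0b] <-].
exact: (isotonic_risk_le hmodel hd hn hlse hrange f0m f0b).
Qed.
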